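(* Let $G_{0,1}(z)$ and $G_{0,2}(z)$ be the generating functions (by length $n$, variable $z$) of walks $0=y_0,y_1,\dots,y_n$ with steps $y_i-y_{i-1}\in\{-2,-1,+1,+2\}$, with $y_i\ge1$ for all $1\le i\le n$, ending at $y_n=1$, respectively $y_n=2$. Then, as $n\to\infty$, $$[z^n]G_{0,1}(z)=\frac{1}{\sqrt{5\pi}}\frac{4^n}{n^{3/2}}\left(1-\frac{81}{200}\frac1n+O\!\left(\frac1{n^2}\right)\right),$$ $$[z^n]G_{0,2}(z)=\frac{5+\sqrt5}{10\sqrt\pi}\frac{4^n}{n^{3/2}}\left(1-\frac{201+24\sqrt5}{200}\frac1n+O\!\left(\frac1{n^2}\right)\right).$$ *)

(* Defs.v *)
From Stdlib Require Import Reals ZArith List.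
Import ListNotations.
Open Scope R_scope.

Definition steps : list Z := [(-2)%Z; (-1)%Z; 1%Z; 2%Z].

Fixpoint step_seqs (n : nat) : list (list Z) :=
  match n with
  | O => [[]]
  | S m => flat_map (fun s => map (fun d => d :: s) steps) (step_seqs m)
  end.

Fixpoint valid_from (y : Z) (l : list Z) (k : Z) : bool :=
  match l with
  | [] => Z.eqb y k
  | d :: l' => Z.ltb 0 (y + d) && valid_from (y + d) l' k
  end.

(* [walks n k] = [z^n] G_{0,k}(z): number of walks 0 = y_0, ..., y_n with
   steps in {-2,-1,1,2}, y_i >= 1 for 1 <= i <= n, and y_n = k. *)
Definition walks (n : nat) (k : Z) : nat :=
  length (filter (fun l => valid_from 0%Z l k) (step_seqs n)).

Definition asymp_expansion (a : nat -> R) (A c : R) : Prop :=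
  exists (K : R) (N : nat), forall n : nat, (N <= n)%nat ->
    Rabs (a n - A * 4 ^ n / (INR n * sqrt (INR n)) * (1 - c / INR n))
      <= K * (4 ^ n / (INR n * sqrt (INR n))) / (INR n ^ 2).

(* Main.v *)
Require Import Defs.
From Stdlib Require Import Reals ZArith List Lra Lia Psatz.
From Coquelicot Require Import Coquelicot.
Open Scope R_scope.

(** With [t = G_{0,1}(z)] the kernel method gives [z = w / (1 + w)^2] for [w = t + t^2] (so that
    [1 + w] is the Catalan generating function) and [G_{0,2} = t^2 + t / (1 + t)]. Let
    [A_k(n)] be the [k]-th cosine coefficient of [(2 cos x + 2 cos 2x)^n] and [B_k(n)] that of
    [(2 + 2 cos x)^n]; their generating functions in [n] are rational in [t] as well, and
    comparing derivatives in [t] gives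
      [n [z^n] G_{0,1} = A_1(n)],
      [n (2 [z^n] G_{0,2} - [z^(n+1)] G_{0,1}) = B_1(n) - 3 A_3(n)].
    [B_1(n)] is a Wallis integral. For [A_k(n)], Laplace's method is run against the comparison
    function [(1 + 5/4 x^2)^(-n)], whose moments become Wallis integrals under
    [x = 2/sqrt 5 tan phi]; the Wallis integrals satisfy
    [pi/4 / (n + 1/4 + 1/(32n)) <= I_{2n}^2 <= pi/4 / (n + 1/4)]. *)

(** Let [u1], [u2] be the two small roots of [1 = z (u^-2 + u^-1 + u + u^2)]. Then [t = u1 + u2] and
    [u1 u2 = - t / (1 + t)], while [n [z^n] (u1^k + u2^k) = k A_k(n)] and [n [z^n] w = B_1(n)]. The
    two identities of the overview are instances of this: [G_{0,1}] is [u1 + u2], and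
    [2 G_{0,2} - G_{0,1} / z] is [w - 1 - (u1^3 + u2^3)]. None of this root calculus is formalized.
    For a fixed small real [t] an explicit bounded vector is checked to solve [Y = a_0 + z T Y];
    iterating this equation makes [Y] the sum of its own series at [z]. As everything is rational in
    [t], the algebra is left to [field], and analysis enters only to pass from equal sums to equal
    coefficients. For the asymptotics a Gaussian would be the usual comparison. The rational power
    has the same two leading terms at 0, and its moments over the whole half-line are complete
    Wallis integrals tied together by rational recurrences, so that every constant stays
    explicit. *)

Ltac as_R_equation := lazymatch goal with |- ?a = ?b => change (@eq R a b) end.

(** * Generating functions as Neumann series *)

(** Linearity is stated for a pointwise decomposition of [u], so that no extensionality of sequences
    is needed. The bound [4] is the sum of the absolute values of the coefficients in each row. *)
Definition linear_bounded (T : (nat -> R) -> nat -> R) : Prop :=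
  (forall u x y c, (forall j, u j = x j + c * y j) ->
     forall j, T u j = T x j + c * T y j) /\
  (forall x B, (forall j, Rabs (x j) <= B) -> forall j, Rabs (T x j) <= 4 * B).

(* Iterating [Y = a 0 + z T Y] gives [Y = sum_(n <= N) z^n a n + z^(N+1) T^(N+1) Y]. *)
Lemma neumann_series T (a : nat -> nat -> R) (Y : nat -> R) z M :
  linear_bounded T ->
  (forall n j, a (S n) j = T (a n) j) ->
  (forall j, Rabs (Y j) <= M) ->
  (forall j, Y j = a O j + z * T Y j) ->
  Rabs (4 * z) < 1 ->
  forall j, is_pseries (fun n => a n j) z (Y j).
Proof.
intros [Tlin Tbd] Ha HM HY Hz.
set (I := fun m => Nat.iter m T Y).
assert (HI : forall m j, I m j = a m j + z * I (S m) j).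
{ induction m as [|m IH]; intros j; [exact (HY j)|].
  rewrite Ha. exact (Tlin _ _ _ _ IH j). }
assert (HB : forall m j, Rabs (I m j) <= 4 ^ m * M).
{ induction m as [|m IH]; intros j; [simpl; specialize (HM j); lra|].
  replace (4 ^ S m * M) with (4 * (4 ^ m * M)) by (simpl; ring).
  exact (Tbd _ _ IH j). }
assert (HS : forall N j, Y j = sum_n (fun n => a n j * z ^ n) N + z ^ S N * I (S N) j).
{ induction N as [|N IH]; intros j.
  - rewrite sum_O. simpl. rewrite HY. simpl. ring.
  - rewrite sum_Sn, (IH j), (HI (S N) j). unfold plus; simpl. ring. }
intros j. apply is_pseries_R.
change (is_lim_seq (sum_n (fun n => a n j * z ^ n)) (Y j)).
apply is_lim_seq_ext with (fun N => Y j - (z ^ S N * I (S N) j)).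
{ intros N. rewrite (HS N j). ring. }
rewrite <- (Rminus_0_r (Y j)).
apply is_lim_seq_minus'; [rewrite Rminus_0_r; apply is_lim_seq_const|].
apply is_lim_seq_abs_0.
apply is_lim_seq_le_le with (fun _ => 0) (fun N => Rabs (4 * z) ^ S N * M).
- intros N; split; [apply Rabs_pos|].
  rewrite Rabs_mult, RPow_abs, Rpow_mult_distr, Rabs_mult.
  rewrite (Rabs_pos_eq (4 ^ S N)) by (apply pow_le; lra).
  assert (H := HB (S N) j). assert (H' := Rabs_pos (z ^ S N)). nra.
- apply is_lim_seq_const.
- replace (Finite 0) with (Rbar_mult 0 M) by (simpl; f_equal; ring).
  apply is_lim_seq_scal_r.
  apply (is_lim_seq_incr_1 (fun N => Rabs (4 * z) ^ N)).
  apply is_lim_seq_geom. now rewrite Rabs_Rabsolu.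
Qed.

(* [T_walk]: walks killed below height 1, index [j] standing for height [j + 1].
   [T_refl] and [T_lazy]: multiplication by [2 cos x + 2 cos 2x] and [2 + 2 cos x] on cosine
   coefficients. *)
Definition T_walk (x : nat -> R) (j : nat) : R :=
  match j with
  | 0%nat => x 1%nat + x 2%nat
  | 1%nat => x 0%nat + x 2%nat + x 3%nat
  | S (S i) => x i + x (S i) + x (S (S (S i))) + x (S (S (S (S i))))
  end.

Definition T_refl (x : nat -> R) (j : nat) : R :=
  match j with
  | 0%nat => 2 * x 1%nat + 2 * x 2%nat
  | 1%nat => x 0%nat + x 1%nat + x 2%nat + x 3%nat
  | S (S i) => x i + x (S i) + x (S (S (S i))) + x (S (S (S (S i))))
  end.

Definition T_lazy (x : nat -> R) (j : nat) : R :=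
  match j with
  | 0%nat => 2 * x 0%nat + 2 * x 1%nat
  | S i => x i + 2 * x (S i) + x (S (S i))
  end.

Ltac lin_bd :=
  split;
  [ intros u x y c H [|[|j]]; simpl; rewrite !H; ring
  | intros x B H [|[|j]]; simpl; apply Rabs_le;
    repeat match goal with |- context [x ?k] =>
      assert (-B <= x k <= B) by (apply Rabs_le_between; apply H);
      generalize dependent (x k); intros end; lra ].

Lemma T_walk_linear_bounded : linear_bounded T_walk.
Proof. lin_bd. Qed.

Lemma T_refl_linear_bounded : linear_bounded T_refl.
Proof. lin_bd. Qed.

Lemma T_lazy_linear_bounded : linear_bounded T_lazy.
Proof. lin_bd. Qed.

(** * Walks and their generating functions *)

(** The end point is fixed and the start varies, because removing the head of a step sequence moves
    the start. *)
Definition walks_from (y : Z) (n : nat) (k : Z) : nat :=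
  length (filter (fun l => valid_from y l k) (step_seqs n)).

Lemma walks_from_S y n k :
  let w d := if Z.ltb 0 (y + d) then walks_from (y + d) n k else 0%nat in
  walks_from y (S n) k = (w (-2)%Z + w (-1)%Z + w 1%Z + w 2%Z)%nat.
Proof.
unfold walks_from; simpl.
induction (step_seqs n) as [|s L IH].
- simpl. now repeat destruct (Z.ltb _ _).
- simpl in *. unfold valid_from at 1 2 3 4; fold valid_from.
  destruct (Z.ltb 0 (y + -2)), (Z.ltb 0 (y + -1)), (Z.ltb 0 (y + 1)), (Z.ltb 0 (y + 2));
  simpl;
  try destruct (valid_from (y + -2) s k);
  try destruct (valid_from (y + -1) s k);
  try destruct (valid_from (y + 1) s k);
  try destruct (valid_from (y + 2) s k); simpl; lia.
Qed.

Definition walks_above (k : Z) (n j : nat) : R := INR (walks_from (Z.of_nat (S j)) n k).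

Lemma walks_above_S k n j : walks_above k (S n) j = T_walk (walks_above k n) j.
Proof.
unfold walks_above. rewrite walks_from_S. cbv zeta.
destruct j as [|[|j]]; unfold T_walk.
- rewrite !plus_INR; simpl; ring.
- rewrite !plus_INR; simpl; ring.
- rewrite !(proj2 (Z.ltb_lt _ _)) by lia. rewrite !plus_INR.
  repeat (f_equal; try lia).
Qed.

Lemma walks_S k n :
  INR (walks (S n) k) = walks_above k n 0 + walks_above k n 1.
Proof.
change (walks (S n) k) with (walks_from 0 (S n) k).
rewrite walks_from_S. cbv zeta. rewrite !plus_INR. unfold walks_above. simpl. ring.
Qed.

Lemma walks_above_0 k j :
  walks_above k 0 j = if Z.eqb (Z.of_nat (S j)) k then 1 else 0.
Proof.
unfold walks_above, walks_from. simpl step_seqs. cbn [filter valid_from].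
now destruct (Z.eqb _ _).
Qed.

(** Used with [p = t], [q = t / (1 + t)], where the characteristic equation
    [u^2 = t u + t / (1 + t)] has exactly the two small kernel roots. These are irrational in [t],
    and complex for small negative [t]; the recurrence gives their combinations without naming
    them. *)
Fixpoint linrec (p q x0 x1 : R) (n : nat) : R :=
  match n with
  | O => x0
  | S m => match m with
           | O => x1
           | S l => p * linrec p q x0 x1 m + q * linrec p q x0 x1 l
           end
  end.

Lemma linrec_SS p q x0 x1 n :
  linrec p q x0 x1 (S (S n)) = p * linrec p q x0 x1 (S n) + q * linrec p q x0 x1 n.
Proof. reflexivity. Qed.

Lemma linrec_bounded p q x0 x1 :
  Rabs p + Rabs q <= 1 ->
  exists M, forall n, Rabs (linrec p q x0 x1 n) <= M.
Proof.
intros H. set (M := Rabs x0 + Rabs x1). exists M.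
assert (HM : 0 <= M) by (assert (h0 := Rabs_pos x0); assert (h1 := Rabs_pos x1); unfold M; lra).
assert (G : forall n, Rabs (linrec p q x0 x1 n) <= M /\ Rabs (linrec p q x0 x1 (S n)) <= M).
{ induction n as [|n [I1 I2]].
  - assert (h0 := Rabs_pos x0); assert (h1 := Rabs_pos x1). simpl; unfold M; lra.
  - split; [exact I2|]. rewrite linrec_SS.
    eapply Rle_trans; [apply Rabs_triang|]. rewrite !Rabs_mult.
    assert (hp := Rabs_pos p); assert (hq := Rabs_pos q). nra. }
intros n; apply G.
Qed.

(* [z] as a function of [t = G_{0,1}(z)]. *)
Definition zpar (t : R) : R := t * (1 + t) / (1 + t + t * t) ^ 2.

(* [u^2 - t u + t/(1+t)] divides [z (u^4 + u^3 + u + 1) - u^2] for [z = zpar t]. *)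
Lemma linrec_kernel t x0 x1 n :
  Rabs t <= 1 / 4 ->
  let X := linrec t (t / (1 + t)) x0 x1 in
  X (S (S n)) = zpar t * (X n + X (S n) + X (S (S (S n))) + X (S (S (S (S n))))).
Proof.
intros Ht X.
assert (-1/4 <= t <= 1/4) by (apply Rabs_le_between in Ht; lra).
unfold X. rewrite !linrec_SS.
generalize (linrec t (t / (1 + t)) x0 x1 n) (linrec t (t / (1 + t)) x0 x1 (S n)).
intros a b. unfold zpar. field. split; nra.
Qed.

Lemma linrec_coeffs_small t : Rabs t <= 1 / 4 -> Rabs t + Rabs (t / (1 + t)) <= 1.
Proof.
intros Ht. assert (H : -(1/4) <= t <= 1/4) by (apply Rabs_le_between in Ht; lra).
replace (Rabs (t / (1 + t))) with (Rabs t / (1 + t)).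
- apply Rmult_le_reg_r with (1 + t); [lra|]. field_simplify; [|lra].
  assert (h := Rabs_pos t). nra.
- unfold Rdiv. rewrite Rabs_mult, Rabs_inv, (Rabs_pos_eq (1 + t)) by lra. reflexivity.
Qed.

Lemma zpar_small t : Rabs t <= 1 / 8 -> Rabs (4 * zpar t) < 1.
Proof.
intros Ht. assert (H : -(1/8) <= t <= 1/8) by (apply Rabs_le_between in Ht; lra).
unfold zpar. assert (0 < (1 + t + t * t) ^ 2) by (apply pow_lt; nra).
replace (4 * (t * (1 + t) / (1 + t + t * t) ^ 2)) with (4 * (t * (1 + t)) / (1 + t + t * t) ^ 2)
  by (field; nra).
apply Rabs_def1.
- apply Rmult_lt_reg_r with ((1 + t + t * t) ^ 2); [lra|]. field_simplify; nra.
- apply Rmult_lt_reg_r with ((1 + t + t * t) ^ 2); [lra|]. field_simplify; nra.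
Qed.

(** The kernel divisibility settles all indices from 2 on, where the operators agree. Only the
    boundary equations at 0 and 1 distinguish them, and these two determine the choice of [x0] and
    [x1]. *)
Lemma linrec_series t T (a : nat -> nat -> R) x0 x1 :
  Rabs t <= 1 / 8 ->
  let X := linrec t (t / (1 + t)) x0 x1 in
  linear_bounded T ->
  (forall n j, a (S n) j = T (a n) j) ->
  (forall i, a O (S (S i)) = 0) ->
  (forall i, T X (S (S i)) = X i + X (S i) + X (S (S (S i))) + X (S (S (S (S i))))) ->
  X 0%nat = a 0%nat 0%nat + zpar t * T X 0%nat ->
  X 1%nat = a 0%nat 1%nat + zpar t * T X 1%nat ->
  forall j, is_pseries (fun n => a n j) (zpar t) (X j).
Proof.
intros Ht X HT Ha H0 HX E0 E1.
destruct (linrec_bounded t (t / (1 + t)) x0 x1) as [M HM].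
{ apply linrec_coeffs_small; lra. }
apply (neumann_series T a X (zpar t) M HT Ha HM); [|now apply zpar_small].
intros [|[|j]]; [exact E0|exact E1|].
rewrite H0, Rplus_0_l, HX. apply (linrec_kernel t x0 x1 j). lra.
Qed.

(** [x] and [t * x] are the generating functions of walks to 1 from heights 1 and 2. Prepending the
    first step from 0 gives [z (x + t x) = t], which is why [t] is the right parameter. *)
Lemma walks_above_1_series t j :
  Rabs t <= 1 / 8 ->
  let x := (1 + t + t * t) ^ 2 / (1 + t) ^ 2 in
  is_pseries (fun n => walks_above 1 n j) (zpar t) (linrec t (t / (1 + t)) x (t * x) j).
Proof.
intros Ht x. assert (Hb : -(1/8) <= t <= 1/8) by (apply Rabs_le_between in Ht; lra).
apply (linrec_series t T_walk (walks_above 1) _ _ Ht).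
- apply T_walk_linear_bounded.
- intros; apply walks_above_S.
- intros i. rewrite walks_above_0, (proj2 (Z.eqb_neq _ _)) by lia. reflexivity.
- reflexivity.
- rewrite walks_above_0. unfold T_walk; rewrite !linrec_SS. simpl. unfold x, zpar. field; split; nra.
- rewrite walks_above_0. unfold T_walk; rewrite !linrec_SS. simpl. unfold x, zpar. field; split; nra.
Qed.

Lemma walks_above_2_series t j :
  Rabs t <= 1 / 8 ->
  let x := (1 + t + t * t) ^ 2 / (1 + t) ^ 2 in
  is_pseries (fun n => walks_above 2 n j) (zpar t)
    (linrec t (t / (1 + t)) (t * x) ((1 + t * t) * x) j).
Proof.
intros Ht x. assert (Hb : -(1/8) <= t <= 1/8) by (apply Rabs_le_between in Ht; lra).
apply (linrec_series t T_walk (walks_above 2) _ _ Ht).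
- apply T_walk_linear_bounded.
- intros; apply walks_above_S.
- intros i. rewrite walks_above_0, (proj2 (Z.eqb_neq _ _)) by lia. reflexivity.
- reflexivity.
- rewrite walks_above_0. unfold T_walk; rewrite !linrec_SS. simpl. unfold x, zpar. field; split; nra.
- rewrite walks_above_0. unfold T_walk; rewrite !linrec_SS. simpl. unfold x, zpar. field; split; nra.
Qed.

Lemma T_refl_series t (a : nat -> nat -> R) j :
  Rabs t <= 1 / 8 ->
  (forall n i, a (S n) i = T_refl (a n) i) ->
  a 0%nat 0%nat = 1 -> (forall i, a 0%nat (S i) = 0) ->
  let y := (1 + t + t * t) / ((1 - t - t * t) * (1 + 2 * t)) in
  is_pseries (fun n => a n j) (zpar t) (linrec t (t / (1 + t)) y (t * (1 + t) * y) j).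
Proof.
intros Ht Ha H0 H1 y. assert (Hb : -(1/8) <= t <= 1/8) by (apply Rabs_le_between in Ht; lra).
apply (linrec_series t T_refl a _ _ Ht T_refl_linear_bounded Ha).
- intros i; apply H1.
- reflexivity.
- rewrite H0. unfold T_refl; rewrite !linrec_SS. simpl. unfold y, zpar. field; repeat split; nra.
- rewrite H1. unfold T_refl; rewrite !linrec_SS. simpl. unfold y, zpar. field; repeat split; nra.
Qed.

(** For [2 + u + 1/u] the only small kernel root is [w = t + t^2], so the solution is geometric,
    namely [(1 + w) / (1 - w) * w^j]. *)
Lemma T_lazy_series t (a : nat -> nat -> R) j :
  Rabs t <= 1 / 8 ->
  (forall n i, a (S n) i = T_lazy (a n) i) ->
  a 0%nat 0%nat = 1 -> (forall i, a 0%nat (S i) = 0) ->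
  is_pseries (fun n => a n j) (zpar t)
    ((1 + t + t * t) / (1 - t - t * t) * (t + t * t) ^ j).
Proof.
intros Ht Ha H0 H1. assert (Hb : -(1/8) <= t <= 1/8) by (apply Rabs_le_between in Ht; lra).
revert j.
assert (HD : 0 < 1 - t - t * t) by nra.
set (y := (1 + t + t * t) / (1 - t - t * t)).
apply (neumann_series T_lazy a _ _ (Rabs y) T_lazy_linear_bounded Ha).
- intros j. rewrite Rabs_mult, <- RPow_abs.
  assert (h := Rabs_pos y).
  assert (Rabs (t + t * t) ^ j <= 1).
  { rewrite <- (pow1 j). apply pow_incr. split; [apply Rabs_pos|]. apply Rabs_le. nra. }
  nra.
- intros [|j].
  + rewrite H0. unfold T_lazy, y, zpar. simpl. field. split; nra.
  + rewrite H1. unfold T_lazy, y, zpar. simpl. field. split; nra.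
- now apply zpar_small.
Qed.

(** * Coefficient identities *)

(** Two quadratics are solved in turn: [z = w / (1 + w)^2] by [s], then [w = t + t^2] by [r].
    Identities known along the curve in [t] thereby hold on a full real neighbourhood of [z = 0]. *)
Lemma zpar_onto z : Rabs z <= 1 / 100 -> exists t, Rabs t < 1 / 8 /\ zpar t = z.
Proof.
intros Hz. assert (H : -(1/100) <= z <= 1/100) by (apply Rabs_le_between in Hz; lra).
set (s := sqrt (1 - 4 * z)).
assert (Hs : s * s = 1 - 4 * z) by (apply sqrt_sqrt; lra).
assert (Hs0 : 0 <= s) by apply sqrt_pos.
assert (0.97 <= s <= 1.03) by nra.
set (w := (1 - s) / (1 + s)).
assert (Hw : w * (1 + s) = 1 - s) by (unfold w; field; lra).
assert (-(2/100) <= w <= 2/100) by nra.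
set (r := sqrt (1 + 4 * w)).
assert (Hr : r * r = 1 + 4 * w) by (apply sqrt_sqrt; lra).
assert (Hr0 : 0 <= r) by apply sqrt_pos.
assert (0.9 <= r <= 1.1) by nra.
exists ((r - 1) / 2). split; [apply Rabs_def1; lra|].
unfold zpar.
replace ((r - 1) / 2 * (1 + (r - 1) / 2)) with w by nra.
replace (1 + (r - 1) / 2 + (r - 1) / 2 * ((r - 1) / 2)) with (1 + w) by nra.
replace z with ((1 - s * s) / 4) by lra.
unfold w. field. lra.
Qed.

Lemma is_pseries_radius (a : nat -> R) x l :
  is_pseries a x l -> Rbar_le (Rabs x) (CV_radius a).
Proof.
intros H. apply Rbar_not_lt_le. intros H'. apply CV_disk_outside in H'. apply H'.
apply ex_series_lim_0. exists l. now apply is_pseries_R.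
Qed.

Lemma pseries_coeff_unique (a b : nat -> R) r :
  0 < r ->
  (forall z, Rabs z <= r -> exists l, is_pseries a z l /\ is_pseries b z l) ->
  forall n, a n = b n.
Proof.
intros Hr H n.
assert (Habs : Rabs r = r) by (apply Rabs_pos_eq; lra).
destruct (H r) as [l [Ha Hb]]; [lra|].
apply is_pseries_radius in Ha. apply is_pseries_radius in Hb. rewrite Habs in Ha, Hb.
assert (Hfac : INR (Factorial.fact n) <> 0) by apply INR_fact_neq_0.
apply Rmult_eq_reg_r with (INR (Factorial.fact n)); [|exact Hfac].
rewrite <- !Derive_n_coef; [|eapply Rbar_lt_le_trans; [|eassumption]; simpl; lra ..].
apply Derive_n_ext_loc. exists (mkposreal r Hr). intros z Hz.
destruct (H z) as [m [H1 H2]].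
{ change (Rabs (z - 0) < r) in Hz. rewrite Rminus_0_r in Hz. lra. }
now rewrite (is_pseries_unique _ _ _ H1), (is_pseries_unique _ _ _ H2).
Qed.

Definition dzpar (t : R) : R := (1 + 2 * t) * (1 - t - t * t) / (1 + t + t * t) ^ 3.

Lemma is_derive_zpar t : Rabs t <= 1 / 8 -> is_derive zpar t (dzpar t).
Proof.
intros Ht. assert (Hb : -(1/8) <= t <= 1/8) by (apply Rabs_le_between in Ht; lra).
unfold zpar, dzpar. auto_derive; [nra|]. field. nra.
Qed.

(* In the parameter [t], the Euler operator [z d/dz] reads [zpar / dzpar * d/dt]. *)
Lemma pseries_euler_derivative (a b : nat -> R) (f df g : R -> R) :
  (forall t, Rabs t <= 1 / 8 -> is_pseries a (zpar t) (f t)) ->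
  (forall t, Rabs t <= 1 / 8 -> is_pseries b (zpar t) (g t)) ->
  (forall t, Rabs t <= 1 / 8 -> is_derive f t (df t) /\ zpar t * df t = g t * dzpar t) ->
  forall n, INR n * a n = b n.
Proof.
intros Ha Hb Hf n.
enough (E : forall n, PS_incr_1 (PS_derive a) n = b n).
{ rewrite <- E. destruct n as [|n]; simpl; [unfold zero; simpl; ring|reflexivity]. }
(* Half of the range of [zpar_onto]: convergence at [z = 1/100] then places these [z] strictly
   inside the disc, where the series may be differentiated termwise. *)
apply pseries_coeff_unique with (1 / 200); [lra|].
intros z Hz.
destruct (zpar_onto z) as [t [Ht Ez]]; [lra|].
exists (g t). rewrite <- Ez. split; [|apply Hb; lra].
rewrite <- Ez in Hz.
assert (Hr : Rbar_lt (Rabs (zpar t)) (CV_radius a)).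
{ destruct (zpar_onto (1 / 100)) as [t1 [Ht1 E1]]; [rewrite Rabs_pos_eq; lra|].
  apply Rbar_lt_le_trans with (Rabs (zpar t1)).
  - rewrite E1, (Rabs_pos_eq (1 / 100)) by lra. simpl; lra.
  - apply (is_pseries_radius a _ (f t1)). apply Ha. lra. }
assert (Hd := is_derive_PSeries _ _ Hr).
assert (Hs := is_pseries_incr_1 _ _ _ (PSeries_correct _ _ (ex_pseries_derive _ _ Hr))).
change (scal ?x ?y) with (x * y) in Hs.
replace (g t) with (zpar t * PSeries (PS_derive a) (zpar t)); [exact Hs|].
assert (Hbt : -(1/8) < t < 1/8) by (apply Rabs_def2 in Ht; lra).
destruct (Hf t) as [Hf' Hg]; [lra|].
assert (Hc := is_derive_comp (PSeries a) zpar t _ _ Hd (is_derive_zpar t (Rlt_le _ _ Ht))).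
assert (Hc' : is_derive f t (dzpar t * PSeries (PS_derive a) (zpar t))).
{ eapply is_derive_ext_loc; [|exact Hc].
  assert (He : 0 < 1 / 8 - Rabs t) by lra.
  exists (mkposreal _ He). intros u Hu. change (Rabs (u - t) < 1 / 8 - Rabs t) in Hu.
  apply is_pseries_unique, Ha.
  replace u with ((u - t) + t) by ring. eapply Rle_trans; [apply Rabs_triang|]. lra. }
assert (Eq := is_derive_unique _ _ _ Hc'). rewrite (is_derive_unique _ _ _ Hf') in Eq.
apply Rmult_eq_reg_r with (dzpar t).
- rewrite <- Hg, Eq. ring.
- unfold dzpar, Rdiv. repeat apply Rmult_integral_contrapositive_currified; try nra.
  apply Rinv_neq_0_compat. apply pow_nonzero. nra.
Qed.

(** Since [G_{0,1}] is the parameter itself, its Euler derivative is [zpar / dzpar], and this is the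
    entry of index 1 in [T_refl_series]. *)
Lemma walks_1_euler (a : nat -> nat -> R) :
  (forall n i, a (S n) i = T_refl (a n) i) ->
  a 0%nat 0%nat = 1 -> (forall i, a 0%nat (S i) = 0) ->
  forall n, INR n * INR (walks n 1) = a n 1%nat.
Proof.
intros Ha H0 H1.
apply pseries_euler_derivative with (f := fun t => t) (df := fun _ => 1)
  (g := fun t => t * (1 + t) * ((1 + t + t * t) / ((1 - t - t * t) * (1 + 2 * t)))).
- intros t Ht. assert (Hb : -(1/8) <= t <= 1/8) by (apply Rabs_le_between in Ht; lra).
  assert (Hs := is_pseries_incr_1 _ _ _ (is_pseries_plus _ _ _ _ _
    (walks_above_1_series t 0 Ht) (walks_above_1_series t 1 Ht))).
  eapply is_pseries_ext; [|eapply eq_rect; [exact Hs|]].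
  + intros [|n]; [reflexivity|]. rewrite walks_S. reflexivity.
  + change (scal ?x ?y) with (x * y). change (plus ?x ?y) with (x + y).
    simpl. unfold zpar. field. split; nra.
- intros t Ht. exact (T_refl_series t a 1 Ht Ha H0 H1).
- intros t Ht. assert (Hb : -(1/8) <= t <= 1/8) by (apply Rabs_le_between in Ht; lra).
  split; [apply @is_derive_id|]. unfold zpar, dzpar. field. repeat split; nra.
Qed.

(** Here [f] equals [w - 1 - (u1^3 + u2^3)], with [u1^3 + u2^3 = t^3 + 3 t^2 / (1 + t)]. The Euler
    derivative of [w] contributes [b n 1], that of the sum of cubes [3 * a n 3]. *)
Lemma walks_2_euler (a b : nat -> nat -> R) :
  (forall n i, a (S n) i = T_refl (a n) i) ->
  a 0%nat 0%nat = 1 -> (forall i, a 0%nat (S i) = 0) ->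
  (forall n i, b (S n) i = T_lazy (b n) i) ->
  b 0%nat 0%nat = 1 -> (forall i, b 0%nat (S i) = 0) ->
  forall n, INR n * (2 * INR (walks n 2) - INR (walks (S n) 1)) = b n 1%nat - 3 * a n 3%nat.
Proof.
intros Ha H0 H1 Hb H0' H1'.
apply pseries_euler_derivative with
  (f := fun t => 2 * (t * t + t / (1 + t)) - (1 + t + t * t) ^ 2 / (1 + t))
  (df := fun t => 2 * (2 * t + 1 / (1 + t) ^ 2) - (1 + t + t * t) * (1 + 5 * t + 3 * t * t) / (1 + t) ^ 2)
  (g := fun t => (1 + t + t * t) / (1 - t - t * t) * (t + t * t)
     - 3 * linrec t (t / (1 + t)) ((1 + t + t * t) / ((1 - t - t * t) * (1 + 2 * t)))
             (t * (1 + t) * ((1 + t + t * t) / ((1 - t - t * t) * (1 + 2 * t)))) 3).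
- intros t Ht. assert (Hbt : -(1/8) <= t <= 1/8) by (apply Rabs_le_between in Ht; lra).
  assert (Hs1 := is_pseries_plus _ _ _ _ _
    (walks_above_1_series t 0 Ht) (walks_above_1_series t 1 Ht)).
  assert (Hs2 := is_pseries_incr_1 _ _ _ (is_pseries_plus _ _ _ _ _
    (walks_above_2_series t 0 Ht) (walks_above_2_series t 1 Ht))).
  assert (Hs := is_pseries_plus _ _ _ _ _
    (is_pseries_scal 2 _ _ _ (Rmult_comm _ _) Hs2) (is_pseries_scal (-1) _ _ _ (Rmult_comm _ _) Hs1)).
  eapply is_pseries_ext; [|eapply eq_rect; [exact Hs|]].
  + intros n. rewrite (walks_S 1 n). unfold PS_plus, PS_scal.
    destruct n as [|n]; [|rewrite walks_S]; simpl;
    repeat change (scal ?x ?y) with (x * y); repeat change (plus ?x ?y) with (x + y).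
    * change zero with 0. change (INR 0) with 0. ring.
    * ring.
  + repeat change (scal ?x ?y) with (x * y). repeat change (plus ?x ?y) with (x + y).
    simpl. unfold zpar. field. split; nra.
- intros t Ht.
  assert (Hs := is_pseries_plus _ _ _ _ _ (T_lazy_series t b 1 Ht Hb H0' H1')
    (is_pseries_scal (-3) _ _ _ (Rmult_comm _ _) (T_refl_series t a 3 Ht Ha H0 H1))).
  eapply is_pseries_ext; [|eapply eq_rect; [exact Hs|]].
  + intros n. unfold PS_plus, PS_scal. change (scal ?x ?y) with (x * y). change (plus ?x ?y) with (x + y).
    as_R_equation. ring.
  + change (scal ?x ?y) with (x * y). change (plus ?x ?y) with (x + y). rewrite pow_1.
    as_R_equation. ring.
- intros t Ht. assert (Hbt : -(1/8) <= t <= 1/8) by (apply Rabs_le_between in Ht; lra).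
  split.
  + auto_derive; [lra|]. field. lra.
  + unfold zpar, dzpar. simpl. field. repeat split; nra.
Qed.

(** * Cosine coefficients *)

Lemma ex_RInt_derivable (f : R -> R) a b : (forall x, ex_derive f x) -> ex_RInt f a b.
Proof.
intros H. apply (@ex_RInt_continuous R_CompleteNormedModule). intros x _.
apply (ex_derive_continuous (V := R_NormedModule)). apply H.
Qed.

Lemma is_RInt_Rplus (f g : R -> R) a b lf lg :
  is_RInt f a b lf -> is_RInt g a b lg -> is_RInt (fun x => f x + g x) a b (lf + lg).
Proof. apply (is_RInt_plus (V := R_NormedModule)). Qed.

Lemma is_RInt_Rscal (f : R -> R) c a b l :
  is_RInt f a b l -> is_RInt (fun x => c * f x) a b (c * l).
Proof. apply (is_RInt_scal (V := R_NormedModule)). Qed.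

Lemma is_RInt_Rminus (f g : R -> R) a b lf lg :
  is_RInt f a b lf -> is_RInt g a b lg -> is_RInt (fun x => f x - g x) a b (lf - lg).
Proof. apply (is_RInt_minus (V := R_NormedModule)). Qed.

Lemma is_RInt_Runique (f : R -> R) a b l : is_RInt f a b l -> RInt f a b = l.
Proof. apply (is_RInt_unique (V := R_CompleteNormedModule)). Qed.

Lemma is_RInt_Rderive (f df : R -> R) a b :
  (forall x, is_derive f x (df x)) -> (forall x, ex_derive df x) ->
  is_RInt df a b (f b - f a).
Proof.
intros H1 H2. apply (is_RInt_derive (V := R_CompleteNormedModule) f df).
- intros x _. apply H1.
- intros x _. apply (ex_derive_continuous (V := R_NormedModule)). apply H2.
Qed.

(** For an even trigonometric polynomial [P] this is the coefficient of [u^j] in [P^n] with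
    [u = exp(i x)]; evenness permits the half range. *)
Definition trig_moment (P : R -> R) (n j : nat) : R :=
  / PI * RInt (fun x => P x ^ n * cos (INR j * x)) 0 PI.

Lemma trig_moment_S P n j c1 k1 c2 k2 c3 k3 c4 k4 :
  (forall x, ex_derive P x) ->
  (forall x, P x * cos (INR j * x) = c1 * cos (INR k1 * x) + c2 * cos (INR k2 * x)
     + c3 * cos (INR k3 * x) + c4 * cos (INR k4 * x)) ->
  trig_moment P (S n) j = c1 * trig_moment P n k1 + c2 * trig_moment P n k2
     + c3 * trig_moment P n k3 + c4 * trig_moment P n k4.
Proof.
intros HP H. unfold trig_moment.
assert (HI : forall k, is_RInt (fun x => P x ^ n * cos (INR k * x)) 0 PI
    (RInt (fun x => P x ^ n * cos (INR k * x)) 0 PI)).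
{ intros k. apply (@RInt_correct R_CompleteNormedModule). apply ex_RInt_derivable.
  intros x. auto_derive. auto. }
assert (Hs := is_RInt_Rplus _ _ _ _ _ _ (is_RInt_Rplus _ _ _ _ _ _ (is_RInt_Rplus _ _ _ _ _ _
  (is_RInt_Rscal _ c1 _ _ _ (HI k1)) (is_RInt_Rscal _ c2 _ _ _ (HI k2)))
  (is_RInt_Rscal _ c3 _ _ _ (HI k3))) (is_RInt_Rscal _ c4 _ _ _ (HI k4))).
apply is_RInt_Runique in Hs.
transitivity (/ PI * (c1 * RInt (fun x => P x ^ n * cos (INR k1 * x)) 0 PI
  + c2 * RInt (fun x => P x ^ n * cos (INR k2 * x)) 0 PI
  + c3 * RInt (fun x => P x ^ n * cos (INR k3 * x)) 0 PI
  + c4 * RInt (fun x => P x ^ n * cos (INR k4 * x)) 0 PI)); [|ring].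
rewrite <- Hs. f_equal. apply RInt_ext. intros x _. simpl.
transitivity (P x ^ n * (P x * cos (INR j * x))); [ring|]. rewrite H. ring.
Qed.

Lemma trig_moment_0_0 P : trig_moment P 0 0 = 1.
Proof.
unfold trig_moment. rewrite (RInt_ext _ (fun _ => 1)).
- rewrite RInt_const. change (/ PI * ((PI - 0) * 1) = 1). rewrite Rminus_0_r, Rmult_1_r. apply Rinv_l. apply PI_neq0.
- intros x _. simpl. rewrite Rmult_0_l, cos_0. ring.
Qed.

Lemma trig_moment_0_S P j : trig_moment P 0 (S j) = 0.
Proof.
unfold trig_moment.
assert (Hj : INR (S j) <> 0) by (apply not_0_INR; lia).
rewrite (RInt_ext _ (fun x => cos (INR (S j) * x))) by (intros x _; simpl; ring).
rewrite (is_RInt_Runique _ 0 PI 0); [ring|].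
replace 0 with (sin (INR (S j) * PI) / INR (S j) - sin (INR (S j) * 0) / INR (S j)) at 2.
- apply (is_RInt_Rderive (fun x => sin (INR (S j) * x) / INR (S j))); intros x.
  + revert Hj. generalize (INR (S j)). intros k Hk. auto_derive; [exact I|]. field. exact Hk.
  + auto_derive. auto.
- rewrite Rmult_0_r, sin_0. replace (sin (INR (S j) * PI)) with 0; [unfold Rdiv; ring|].
  symmetry. apply sin_eq_0_1. exists (Z.of_nat (S j)). now rewrite <- INR_IZR_INZ.
Qed.

Definition symb (x : R) : R := 2 * cos x + 2 * cos (2 * x).
Definition symb_lazy (x : R) : R := 2 + 2 * cos x.

Lemma cos_mult x y : 2 * cos x * cos y = cos (y - x) + cos (y + x).
Proof. rewrite cos_minus, cos_plus. ring. Qed.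

Lemma trig_moment_symb_S n j :
  trig_moment symb (S n) j = T_refl (trig_moment symb n) j.
Proof.
assert (HP : forall x, ex_derive symb x) by (intros x; unfold symb; auto_derive; auto).
destruct j as [|[|j]]; unfold T_refl.
- rewrite (trig_moment_S symb n 0 2 1 2 2 0 0 0 0 HP); [ring|].
  intros x. unfold symb. simpl.
  replace (1 + 1) with 2 by ring. rewrite !Rmult_0_l, cos_0, !Rmult_1_l. ring.
- rewrite (trig_moment_S symb n 1 1 0 1 1 1 2 1 3 HP); [ring|].
  intros x. unfold symb. rewrite Rmult_plus_distr_r, !cos_mult. simpl.
  replace (1 * x - x) with (0 * x) by ring. replace (1 * x + x) with ((1 + 1) * x) by ring.
  replace (1 * x - 2 * x) with (- (1 * x)) by ring. rewrite cos_neg.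
  replace (1 * x + 2 * x) with ((1 + 1 + 1) * x) by ring. ring.
- rewrite (trig_moment_S symb n (S (S j)) 1 j 1 (S j) 1 (S (S (S j))) 1 (S (S (S (S j)))) HP); [ring|].
  intros x. unfold symb. rewrite Rmult_plus_distr_r, !cos_mult. rewrite !S_INR.
  rewrite !Rmult_1_l, <- !Rplus_assoc.
  replace ((INR j + 1 + 1) * x - x) with ((INR j + 1) * x) by ring.
  replace ((INR j + 1 + 1) * x + x) with ((INR j + 1 + 1 + 1) * x) by ring.
  replace ((INR j + 1 + 1) * x - 2 * x) with (INR j * x) by ring.
  replace ((INR j + 1 + 1) * x + 2 * x) with ((INR j + 1 + 1 + 1 + 1) * x) by ring. ring.
Qed.

Lemma trig_moment_symb_lazy_S n j :
  trig_moment symb_lazy (S n) j = T_lazy (trig_moment symb_lazy n) j.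
Proof.
assert (HP : forall x, ex_derive symb_lazy x) by (intros x; unfold symb_lazy; auto_derive; auto).
destruct j as [|j]; unfold T_lazy.
- rewrite (trig_moment_S symb_lazy n 0 2 0 2 1 0 0 0 0 HP); [ring|].
  intros x. unfold symb_lazy. simpl.
  replace (1 + 1) with 2 by ring. rewrite !Rmult_0_l, cos_0, !Rmult_1_l. ring.
- rewrite (trig_moment_S symb_lazy n (S j) 1 j 2 (S j) 1 (S (S j)) 0 0 HP); [ring|].
  intros x. unfold symb_lazy. rewrite Rmult_plus_distr_r, !cos_mult. rewrite !S_INR.
  replace ((INR j + 1) * x - x) with (INR j * x) by ring.
  replace ((INR j + 1) * x + x) with ((INR j + 1 + 1) * x) by ring. ring.
Qed.

(** * Wallis integrals *)

Definition wallis (i m : nat) : R :=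
  RInt (fun x => sin x ^ (2 * i) * cos x ^ m) 0 (PI / 2).

Lemma ex_RInt_sin_cos i m a b : ex_RInt (fun x => sin x ^ i * cos x ^ m) a b.
Proof. apply ex_RInt_derivable. intros x. auto_derive. auto. Qed.

Lemma is_RInt_wallis i m :
  is_RInt (fun x => sin x ^ (2 * i) * cos x ^ m) 0 (PI / 2) (wallis i m).
Proof. apply (@RInt_correct R_CompleteNormedModule). apply ex_RInt_sin_cos. Qed.

(* Integrate the derivative of [sin^(2i+1) cos^(m+1)]. *)
Lemma wallis_S i m : (INR m + 1) * wallis (S i) m = (2 * INR i + 1) * wallis i (S (S m)).
Proof.
set (F := fun x => sin x ^ S (2 * i) * cos x ^ S m).
set (f := fun x => (2 * INR i + 1) * (sin x ^ (2 * i) * cos x ^ S (S m))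
   - (INR m + 1) * (sin x ^ (2 * S i) * cos x ^ m)).
assert (H1 : is_RInt f 0 (PI / 2) 0).
{ replace 0 with (F (PI / 2) - F 0) at 2.
  - apply (is_RInt_Rderive F f); intros x.
    + unfold F, f. replace (2 * S i)%nat with (S (S (2 * i))) by lia.
      assert (E : INR (S (2 * i)) = 2 * INR i + 1) by (rewrite S_INR, mult_INR; simpl; ring).
      revert E. generalize (2 * i)%nat. intros k E. auto_derive; [exact I|].
      change (match k with 0%nat => 1 | S _ => INR k + 1 end) with (INR (S k)).
      rewrite E. change (match m with 0%nat => 1 | S _ => INR m + 1 end) with (INR (S m)).
      rewrite S_INR. simpl. ring.
    + unfold f. auto_derive. auto.
  - unfold F. rewrite cos_PI2, sin_0, !pow_i by lia. ring. }
assert (H2 := is_RInt_Rminus _ _ _ _ _ _ (is_RInt_Rscal _ (2 * INR i + 1) _ _ _ (is_RInt_wallis i (S (S m))))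
  (is_RInt_Rscal _ (INR m + 1) _ _ _ (is_RInt_wallis (S i) m))).
apply is_RInt_Runique in H1. apply is_RInt_Runique in H2.
change (RInt f 0 (PI / 2) = (2 * INR i + 1) * wallis i (S (S m)) - (INR m + 1) * wallis (S i) m) in H2.
lra.
Qed.

Lemma wallis_1 m : wallis 1 m = wallis 0 m - wallis 0 (S (S m)).
Proof.
assert (H := is_RInt_Rminus _ _ _ _ _ _ (is_RInt_wallis 0 m) (is_RInt_wallis 0 (S (S m)))).
apply is_RInt_Runique in H. unfold wallis at 2 3. unfold wallis in H. rewrite <- H.
apply RInt_ext. intros x _. simpl.
replace (sin x * (sin x * 1)) with (1 - cos x * cos x); [ring|].
generalize (sin2_cos2 x). unfold Rsqr. lra.
Qed.

Lemma wallis_0_SS m : (INR m + 2) * wallis 0 (S (S m)) = (INR m + 1) * wallis 0 m.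
Proof. generalize (wallis_S 0 m). rewrite wallis_1. simpl. lra. Qed.

Lemma wallis_0_0 : wallis 0 0 = PI / 2.
Proof.
unfold wallis. rewrite (RInt_ext _ (fun _ => 1)).
- rewrite RInt_const. change ((PI / 2 - 0) * 1 = PI / 2). ring.
- intros; simpl; ring.
Qed.

Lemma wallis_0_1 : wallis 0 1 = 1.
Proof.
apply is_RInt_Runique.
replace 1 with (sin (PI / 2) - sin 0) by (rewrite sin_PI2, sin_0; ring).
apply (is_RInt_ext cos); [intros; simpl; ring|].
apply (is_RInt_Rderive sin); intros x; auto_derive; auto. ring.
Qed.

Lemma cos_unit x : 0 < x < PI / 2 -> 0 <= cos x <= 1.
Proof.
intros H. split; [apply Rlt_le, cos_gt_0; lra|]. apply COS_bound.
Qed.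

Lemma wallis_0_decr m : wallis 0 (S m) <= wallis 0 m.
Proof.
assert (hPI := PI_RGT_0).
apply RInt_le; [lra|apply ex_RInt_sin_cos|apply ex_RInt_sin_cos|].
intros x Hx. apply cos_unit in Hx. simpl.
assert (0 <= cos x ^ m) by (apply pow_le; lra). nra.
Qed.

Lemma wallis_0_pos m : 0 < wallis 0 m.
Proof.
enough (0 < wallis 0 m /\ 0 < wallis 0 (S m)) by tauto.
induction m as [|m [I1 I2]].
- rewrite wallis_0_0, wallis_0_1. generalize PI_RGT_0. lra.
- split; [exact I2|]. assert (h := wallis_0_SS m). assert (h' := pos_INR m). nra.
Qed.

Lemma wallis_product m : (INR m + 1) * (wallis 0 m * wallis 0 (S m)) = PI / 2.
Proof.
induction m as [|m IH].
- rewrite wallis_0_0, wallis_0_1. simpl. ring.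
- rewrite S_INR, <- IH. assert (h := wallis_0_SS m).
  transitivity (wallis 0 (S m) * ((INR m + 2) * wallis 0 (S (S m)))); [ring|]. rewrite h. ring.
Qed.

Lemma wallis_even_S m :
  wallis 0 (2 * S m) = (2 * INR m + 1) / (2 * INR m + 2) * wallis 0 (2 * m).
Proof.
replace (2 * S m)%nat with (S (S (2 * m))) by lia.
assert (h := wallis_0_SS (2 * m)). rewrite mult_INR in h. simpl INR in h.
assert (h' := pos_INR m).
apply Rmult_eq_reg_l with (2 * INR m + 2); [|lra].
transitivity ((2 * INR m + 1) * wallis 0 (2 * m)); [lra|]. field. lra.
Qed.

(** Neighbouring Wallis integrals decrease and their product is known, which squeezes the square.
    The bounds are coarse and serve only to identify the limit of the two monotone sequences
    below. *)
Lemma wallis_even_sqr_bounds m :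
  PI / (4 * INR m + 2) <= wallis 0 (2 * m) ^ 2 <= PI * (INR m + 1) / (2 * INR m + 1) ^ 2.
Proof.
assert (h' := pos_INR m). assert (hPI := PI_RGT_0).
assert (h := wallis_product (2 * m)). rewrite mult_INR in h. simpl INR in h.
assert (p := wallis_0_pos (2 * m)).
split.
- assert (d := wallis_0_decr (2 * m)).
  apply Rmult_le_reg_r with (4 * INR m + 2); [lra|]. unfold Rdiv.
  rewrite Rmult_assoc, Rinv_l by lra.
  assert (wallis 0 (2 * m) * wallis 0 (S (2 * m)) <= wallis 0 (2 * m) ^ 2) by nra.
  nra.
- assert (d := wallis_0_decr (S (2 * m))). assert (e := wallis_0_SS (2 * m)).
  rewrite mult_INR in e. simpl INR in e.
  apply Rmult_le_reg_r with ((2 * INR m + 1) ^ 2); [nra|]. unfold Rdiv.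
  rewrite Rmult_assoc, Rinv_l by nra.
  set (w0 := wallis 0 (2 * m)) in *. set (w1 := wallis 0 (S (2 * m))) in *.
  set (w2 := wallis 0 (S (S (2 * m)))) in *. set (x := INR m) in *.
  assert ((2 * x + 1) * w0 <= (2 * x + 2) * w1) by nra.
  assert ((2 * x + 1) * w0 * ((2 * x + 1) * w0) <= (2 * x + 2) * w1 * ((2 * x + 1) * w0)).
  { apply Rmult_le_compat_r; [nra|lra]. }
  nra.
Qed.

Lemma Un_cv_of_rate (u : nat -> R) l K :
  (forall n, Rabs (u n - l) <= K / (INR n + 1)) -> Un_cv u l.
Proof.
intros H. apply is_lim_seq_Reals.
assert (L : is_lim_seq (fun n => K * / (INR n + 1)) 0).
{ replace 0 with (K * 0) by ring. apply is_lim_seq_mult'; [apply is_lim_seq_const|].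
  apply (is_lim_seq_ext (fun n => / INR (S n))); [intros n; now rewrite S_INR|].
  apply (is_lim_seq_incr_1 (fun n => / INR n)).
  replace (Finite 0) with (Rbar_inv p_infty) by reflexivity.
  apply is_lim_seq_inv; [apply is_lim_seq_INR|discriminate]. }
apply is_lim_seq_le_le with (fun n => l - K * / (INR n + 1)) (fun n => l + K * / (INR n + 1)).
- intros n. specialize (H n). apply Rabs_le_between in H. unfold Rdiv in H. lra.
- replace (Finite l) with (Finite (l - 0)) by (f_equal; ring).
  apply is_lim_seq_minus'; [apply is_lim_seq_const|exact L].
- replace (Finite l) with (Finite (l + 0)) by (f_equal; ring).
  apply is_lim_seq_plus'; [apply is_lim_seq_const|exact L].
Qed.

(** The range of [c] covers both shifts in use, [1/4] and [1/4 + 1/(32 n)] for [n >= 1]. *)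
Lemma wallis_even_sqr_rate n (c : R) : 1 / 4 <= c <= 1 / 2 ->
  Rabs (wallis 0 (2 * n) ^ 2 * (INR n + c) - PI / 4) <= PI / (INR n + 1).
Proof.
intros Hc.
destruct (wallis_even_sqr_bounds n) as [H1 H2]. assert (h := pos_INR n). assert (hPI := PI_RGT_0).
set (w := wallis 0 (2 * n) ^ 2) in *. set (x := INR n) in *.
apply Rabs_le. split.
- assert (PI / (4 * x + 2) * (x + c) <= w * (x + c)) by (apply Rmult_le_compat_r; lra).
  enough (- (PI / (x + 1)) <= PI / (4 * x + 2) * (x + c) - PI / 4) by lra.
  apply Rminus_le_0.
  replace (_ - _) with (PI * ((x + c) / (4 * x + 2) - 1 / 4 + 1 / (x + 1))) by (field; lra).
  apply Rmult_le_pos; [lra|].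
  replace (_ + _) with ((4 * (x + c) * (x + 1) - (4 * x + 2) * (x + 1) + 4 * (4 * x + 2)) / (4 * (4 * x + 2) * (x + 1)))
    by (field; lra).
  apply Rdiv_le_0_compat; nra.
- assert (w * (x + c) <= PI * (x + 1) / (2 * x + 1) ^ 2 * (x + c)) by (apply Rmult_le_compat_r; lra).
  enough (PI * (x + 1) / (2 * x + 1) ^ 2 * (x + c) - PI / 4 <= PI / (x + 1)) by lra.
  apply Rminus_le_0.
  replace (_ - _) with (PI * (1 / (x + 1) + 1 / 4 - (x + 1) * (x + c) / (2 * x + 1) ^ 2)) by (field; lra).
  apply Rmult_le_pos; [lra|].
  replace (_ - _) with ((4 * (2 * x + 1) ^ 2 + (2 * x + 1) ^ 2 * (x + 1) - 4 * (x + 1) * (x + 1) * (x + c)) /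
    (4 * (2 * x + 1) ^ 2 * (x + 1))) by (field; lra).
  apply Rdiv_le_0_compat; nra.
Qed.

(** The left side increases to [PI / 4]. With a shift [c] and [N = n + 1], the increment is
    proportional to [(1/4 - c) / N + c / (4 N^2)]; [c = 1/4] removes the leading term and leaves
    [1 / (16 N^2)]. *)
Lemma wallis_even_sqr_upper m : wallis 0 (2 * m) ^ 2 * (INR m + 1 / 4) <= PI / 4.
Proof.
apply (growing_ineq (fun m => wallis 0 (2 * m) ^ 2 * (INR m + 1 / 4))).
- intros n. rewrite wallis_even_S, S_INR. assert (h := pos_INR n).
  assert (h2 := pow2_ge_0 (wallis 0 (2 * n))).
  rewrite Rpow_mult_distr, (Rmult_comm (_ ^ 2) (wallis _ _ ^ 2)), Rmult_assoc.
  apply Rmult_le_compat_l; [lra|].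
  apply Rminus_le_0.
  replace (_ - _) with (1 / (16 * (INR n + 1) ^ 2)) by (field; lra).
  apply Rdiv_le_0_compat; nra.
- apply Un_cv_of_rate with PI. intros n. apply wallis_even_sqr_rate. lra.
Qed.

(** The extra [1 / (32 n)] cancels the remaining term of order [n^-2] in the increment; what is left
    is negative of order [n^-3], so this sequence decreases to [PI / 4]. *)
Lemma wallis_even_sqr_lower m :
  PI / 4 <= wallis 0 (2 * S m) ^ 2 * (INR (S m) + (1 / 4 + 1 / (32 * INR (S m)))).
Proof.
set (v := fun m => wallis 0 (2 * S m) ^ 2 * (INR (S m) + (1 / 4 + 1 / (32 * INR (S m))))).
apply (decreasing_ineq v).
- intros n. unfold v. rewrite (wallis_even_S (S n)), (S_INR (S n)), (S_INR n). assert (h := pos_INR n).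
  assert (h2 := pow2_ge_0 (wallis 0 (2 * S n))).
  rewrite Rpow_mult_distr, (Rmult_comm (_ ^ 2) (wallis _ _ ^ 2)), Rmult_assoc.
  apply Rmult_le_compat_l; [lra|].
  set (x := INR n) in *.
  apply Rminus_le_0.
  replace (_ - _) with ((3 * (x + 1) + 4) / (128 * (x + 1) * (x + 2) ^ 3)) by (field; lra).
  apply Rdiv_le_0_compat; [lra|]. apply Rmult_lt_0_compat; [lra|]. apply pow_lt; lra.
- apply Un_cv_of_rate with PI. intros n. unfold v.
  eapply Rle_trans; [apply wallis_even_sqr_rate|].
  + rewrite S_INR. assert (h := pos_INR n).
    assert (0 < 1 / (32 * (INR n + 1)) <= 1 / 32); [|lra]. split.
    * apply Rdiv_lt_0_compat; lra.
    * unfold Rdiv. apply Rmult_le_compat_l; [lra|]. apply Rinv_le_contravar; lra.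
  + rewrite S_INR. assert (h := pos_INR n). unfold Rdiv. apply Rmult_le_compat_l; [apply Rlt_le, PI_RGT_0|].
    apply Rinv_le_contravar; lra.
Qed.

(** * Laplace's method *)

Lemma cos_taylor_2_4 y : -2 <= y <= 2 ->
  1 - y ^ 2 / 2 <= cos y <= 1 - y ^ 2 / 2 + y ^ 4 / 24.
Proof.
intros Hy. destruct (pre_cos_bound y 0) as [H1 H2]; [lra|lra|].
unfold cos_approx, cos_term in H1, H2. simpl in H1, H2. lra.
Qed.

Lemma cos_taylor_6 y : -2 <= y <= 2 ->
  1 - y ^ 2 / 2 + y ^ 4 / 24 - y ^ 6 / 720 <= cos y.
Proof.
intros Hy. destruct (pre_cos_bound y 1) as [H1 H2]; [lra|lra|].
unfold cos_approx, cos_term in H1. simpl in H1. lra.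
Qed.

Lemma pow_one_minus_bounds e n : 0 <= e <= 1 ->
  1 - INR n * e <= (1 - e) ^ n <= 1 - INR n * e + INR n ^ 2 * e ^ 2 / 2.
Proof.
intros He. induction n as [|n [I1 I2]]; [simpl; lra|].
rewrite S_INR. assert (h := pos_INR n). set (k := INR n) in *. simpl ((1 - e) ^ S n).
set (q := (1 - e) ^ n) in *. split.
- assert ((1 - e) * (1 - k * e) <= (1 - e) * q) by (apply Rmult_le_compat_l; lra). nra.
- assert ((1 - e) * q <= (1 - e) * (1 - k * e + k ^ 2 * e ^ 2 / 2)) by (apply Rmult_le_compat_l; lra).
  assert (0 <= k ^ 2 * e ^ 3) by (apply Rmult_le_pos; apply pow_le; lra). nra.
Qed.

(** [symb th / 4] starts [1 - 5/4 x + 17/48 x^2] and [1 / (1 + 5/4 x)] starts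
    [1 - 5/4 x + 25/16 x^2]; hence [29/24 = 25/16 - 17/48]. *)
Lemma symb_defect th : 0 <= th <= 1 / 2 ->
  let x := th ^ 2 in
  let e := 1 - symb th / 4 * (1 + 5 / 4 * x) in
  0 <= e <= 1 /\ Rabs (e - 29 / 24 * x ^ 2) <= x ^ 3 / 2.
Proof.
intros Ht x e.
assert (Hx : 0 <= x <= 1 / 4) by (unfold x; nra).
assert (B : 1 - 5 / 4 * x + 17 / 48 * x ^ 2 - 13 / 288 * x ^ 3 <= symb th / 4 <=
            1 - 5 / 4 * x + 17 / 48 * x ^ 2).
{ destruct (cos_taylor_2_4 th) as [_ U1]; [lra|].
  destruct (cos_taylor_2_4 (2 * th)) as [_ U2]; [lra|].
  assert (L1 := cos_taylor_6 th). assert (L2 := cos_taylor_6 (2 * th)).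
  unfold symb, x. lra. }
set (p := symb th / 4) in *.
assert (H3 : 0 <= x ^ 3 <= x ^ 2 / 4) by (split; nra).
assert (B' : (1 - 5 / 4 * x + 17 / 48 * x ^ 2 - 13 / 288 * x ^ 3) * (1 + 5 / 4 * x) <= p * (1 + 5 / 4 * x) <=
            (1 - 5 / 4 * x + 17 / 48 * x ^ 2) * (1 + 5 / 4 * x)) by (split; apply Rmult_le_compat_r; lra).
assert (H2 : 0 <= x ^ 2 <= 1 / 16) by (split; nra).
assert (H4 : 0 <= x ^ 4 <= x ^ 3 / 4) by (split; nra).
assert (E : 29 / 24 * x ^ 2 - 85 / 192 * x ^ 3 <= e <= 29 / 24 * x ^ 2 - 85 / 192 * x ^ 3 + 13 / 288 * x ^ 3 + 65 / 1152 * x ^ 4).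
{ unfold e. lra. }
clearbody e p x. split; [lra|]. apply Rabs_le. lra.
Qed.

(* The comparison function [(1 + 5/4 th^2)^(-n)] agrees with [(symb th / 4)^n] to second order
   and dominates it, so the quotient is [(1 - e)^n] with [0 <= e]. *)
Lemma laplace_pointwise th n j : 0 <= th <= 1 / 2 -> (j <= 3)%nat ->
  let x := th ^ 2 in
  Rabs ((symb th / 4 * (1 + 5 / 4 * x)) ^ n * cos (INR j * th)
        - (1 - INR j ^ 2 / 2 * x - 29 / 24 * INR n * x ^ 2))
    <= 34 * x ^ 2 + 6 * INR n * x ^ 3 + 2 * INR n ^ 2 * x ^ 4.
Proof.
intros Ht Hj x.
destruct (symb_defect th Ht) as [He1 He2]. fold x in He1, He2.
set (e := 1 - symb th / 4 * (1 + 5 / 4 * x)) in *.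
replace (symb th / 4 * (1 + 5 / 4 * x)) with (1 - e) by (unfold e; ring).
assert (Hx : 0 <= x <= 1 / 4) by (unfold x; nra).
assert (Hjr : 0 <= INR j <= 3).
{ split; [apply pos_INR|]. replace 3 with (INR 3) by (simpl; ring). now apply le_INR. }
(* [j <= 3] and [th <= 1/2] keep [j * th] within the range [[-2, 2]] of the Taylor bounds; the [4]
   lies above [81 / 24]. *)
assert (Hc : 1 - INR j ^ 2 / 2 * x <= cos (INR j * th) <= 1 - INR j ^ 2 / 2 * x + 4 * x ^ 2).
{ destruct (cos_taylor_2_4 (INR j * th)) as [c1 c2]; [nra|].
  assert (INR j ^ 4 <= 81) by (replace 81 with (3 ^ 4) by ring; apply pow_incr; lra).
  assert (0 <= x ^ 2) by nra.
  replace ((INR j * th) ^ 2) with (INR j ^ 2 * x) in c1, c2 by (unfold x; ring).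
  replace ((INR j * th) ^ 4) with (INR j ^ 4 * x ^ 2) in c2 by (unfold x; ring).
  split; nra. }
assert (Hc1 : -1 <= cos (INR j * th) <= 1) by apply COS_bound.
assert (Hj2 : 0 <= INR j ^ 2 <= 9) by nra.
destruct (pow_one_minus_bounds e n He1) as [P1 P2].
assert (hn := pos_INR n).
apply Rabs_le_between in He2.
set (q := (1 - e) ^ n) in *. set (c := cos (INR j * th)) in *. set (k := INR n) in *.
set (s := INR j ^ 2) in *. clearbody q c k s e.
assert (H3 : 0 <= x ^ 3 <= x ^ 2 / 4) by (split; nra).
assert (He3 : 0 <= e <= 2 * x ^ 2) by lra.
assert (He4 : e ^ 2 <= 4 * x ^ 4) by nra.
assert (D : Rabs (q - (1 - 29 / 24 * k * x ^ 2)) <= k * x ^ 3 / 2 + 2 * k ^ 2 * x ^ 4).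
{ assert (k * e - k * (29 / 24 * x ^ 2) <= k * (x ^ 3 / 2)) by nra.
  assert (k * (29 / 24 * x ^ 2) - k * e <= k * (x ^ 3 / 2)) by nra.
  assert (0 <= k ^ 2) by nra.
  assert (k ^ 2 * e ^ 2 <= k ^ 2 * (4 * x ^ 4)) by (apply Rmult_le_compat_l; lra).
  assert (0 <= k ^ 2 * e ^ 2) by (apply Rmult_le_pos; nra).
  apply Rabs_le. lra. }
set (d := q - (1 - 29 / 24 * k * x ^ 2)) in *.
replace (q * c - (1 - s / 2 * x - 29 / 24 * k * x ^ 2)) with
  ((c - (1 - s / 2 * x)) + 29 / 24 * k * x ^ 2 * (1 - c) + d * c) by (unfold d; ring).
assert (D2 : Rabs (d * c) <= k * x ^ 3 / 2 + 2 * k ^ 2 * x ^ 4).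
{ rewrite Rabs_mult. assert (Rabs c <= 1) by (apply Rabs_le; lra).
  assert (h := Rabs_pos d). nra. }
assert (0 <= 1 - c <= 9 / 2 * x) by nra.
assert (0 <= 29 / 24 * k * x ^ 2) by (apply Rmult_le_pos; nra).
assert (0 <= 29 / 24 * k * x ^ 2 * (1 - c) <= 29 / 24 * k * x ^ 2 * (9 / 2 * x)).
{ split; [apply Rmult_le_pos; lra|apply Rmult_le_compat_l; lra]. }
assert (0 <= k * x ^ 3) by (apply Rmult_le_pos; lra).
assert (0 <= x ^ 2) by nra.
apply Rabs_le_between in D2. apply Rabs_le. lra.
Qed.

(* With [x = 2/sqrt 5 tan phi], [s = sin phi], [c = cos phi], [n = m + 5]: the second-order
   approximation and the error bound of [laplace_pointwise], times [c^(2n-2)]. *)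
Definition laplace_kernel (j m : nat) (s c : R) : R :=
  let X := 4 / 5 * s ^ 2 in
  c ^ (2 * m + 8) - INR j ^ 2 / 2 * (X * c ^ (2 * m + 6))
  - 29 / 24 * INR (m + 5) * (X ^ 2 * c ^ (2 * m + 4)).

Definition laplace_error (m : nat) (s c : R) : R :=
  let X := 4 / 5 * s ^ 2 in
  34 * (X ^ 2 * c ^ (2 * m + 4)) + 6 * INR (m + 5) * (X ^ 3 * c ^ (2 * m + 2))
  + 2 * INR (m + 5) ^ 2 * (X ^ 4 * c ^ (2 * m)).

(** Extending the kernel to the full quarter period must cost no more than the error already
    allowed. With [C = c^2 <= 4 X] its first two terms are at most [16 X^2 C^2] and [18 X^2 C^2],
    whence the [34] in the error; the third needs [29/6 <= 6]. *)
Lemma laplace_kernel_tail j m s c : (j <= 3)%nat -> 5 * c ^ 2 <= 16 * s ^ 2 ->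
  Rabs (laplace_kernel j m s c) <= laplace_error m s c.
Proof.
intros Hj Hsc. unfold laplace_kernel, laplace_error. set (X := 4 / 5 * s ^ 2).
rewrite !pow_add, !pow_mult. set (C := c ^ 2).
replace (c ^ 8) with (C ^ 4) by (unfold C; ring).
replace (c ^ 6) with (C ^ 3) by (unfold C; ring).
replace (c ^ 4) with (C ^ 2) by (unfold C; ring).
fold C.
assert (HC : 0 <= C <= 4 * X) by (unfold C, X; nra).
assert (Hj2 : 0 <= INR j ^ 2 <= 9).
{ assert (0 <= INR j <= 3); [|nra].
  split; [apply pos_INR|]. replace 3 with (INR 3) by (simpl; ring). now apply le_INR. }
assert (hn := pos_INR (m + 5)). set (k := INR (m + 5)) in *.
assert (hm : 0 <= C ^ m) by (apply pow_le; lra). set (Q := C ^ m) in *. set (t := INR j ^ 2) in *.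
replace (Q * C ^ 4 - t / 2 * (X * (Q * C ^ 3)) - 29 / 24 * k * (X ^ 2 * (Q * C ^ 2)))
  with (Q * (C ^ 2 * (C ^ 2) - t / 2 * (X * C) * C ^ 2 - 29 / 24 * k * (X ^ 2 * C) * C)) by ring.
replace (34 * (X ^ 2 * (Q * C ^ 2)) + 6 * k * (X ^ 3 * (Q * C)) + 2 * k ^ 2 * (X ^ 4 * Q))
  with (Q * (34 * X ^ 2 * C ^ 2 + 6 * k * (X ^ 3 * C) + 2 * k ^ 2 * X ^ 4)) by ring.
rewrite Rabs_mult, (Rabs_pos_eq Q hm). apply Rmult_le_compat_l; [exact hm|].
assert (0 <= C ^ 2 <= 16 * X ^ 2) by nra.
assert (0 <= X * C <= 4 * X ^ 2) by nra.
assert (0 <= C ^ 2 * C ^ 2 <= 16 * X ^ 2 * C ^ 2) by nra.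
assert (0 <= t / 2 * (X * C) <= 18 * X ^ 2) by nra.
assert (0 <= t / 2 * (X * C) * C ^ 2 <= 18 * X ^ 2 * C ^ 2) by nra.
assert (0 <= X ^ 2 * C) by nra.
assert (0 <= k * (X ^ 2 * C)) by nra.
assert (0 <= k * (X ^ 2 * C) * C <= k * (X ^ 2 * C) * (4 * X)) by nra.
assert (0 <= k ^ 2 * X ^ 4) by (apply Rmult_le_pos; [nra|apply pow_le; lra]).
assert (0 <= k * (X ^ 3 * C)) by (apply Rmult_le_pos; [lra|apply Rmult_le_pos; [apply pow_le|]; lra]).
apply Rabs_le. split; lra.
Qed.

(** Under the substitution [1 + 5/4 th^2 = 1 / c^2], so multiplying [laplace_pointwise] by
    [c^(2n-2)] undoes the comparison factor up to [1 / c^2], which is the Jacobian without its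
    constant [2 / sqrt 5]. *)
Lemma laplace_kernel_bulk j m s c : (j <= 3)%nat -> 0 < c -> s ^ 2 + c ^ 2 = 1 ->
  0 <= s -> 16 * s ^ 2 <= 5 * c ^ 2 ->
  let th := 2 / sqrt 5 * (s / c) in
  Rabs ((symb th / 4) ^ (m + 5) * cos (INR j * th) / c ^ 2 - laplace_kernel j m s c)
  <= laplace_error m s c.
Proof.
intros Hj Hc Hsc Hs Hb th.
assert (Hx : th ^ 2 = 4 / 5 * s ^ 2 / c ^ 2).
{ unfold th. assert (H5 : sqrt 5 <> 0) by (apply Rgt_not_eq, sqrt_lt_R0; lra).
  assert (E : sqrt 5 ^ 2 = 5) by (apply pow2_sqrt; lra).
  replace 5 with (sqrt 5 ^ 2) at 2. field. split; lra. }
assert (H0 : 0 <= th).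
{ unfold th. apply Rmult_le_pos; apply Rdiv_le_0_compat; try lra. apply sqrt_lt_R0; lra. }
assert (Hc2 : 0 < c ^ 2) by nra.
assert (Hx4 : th ^ 2 <= 1 / 4).
{ rewrite Hx. apply Rmult_le_reg_r with (c ^ 2); [lra|]. unfold Rdiv at 1.
  rewrite Rmult_assoc, Rinv_l by lra. lra. }
assert (Ht : 0 <= th <= 1 / 2) by nra.
assert (H := laplace_pointwise th (m + 5) j Ht Hj). cbv zeta in H.
replace (1 + 5 / 4 * th ^ 2) with (/ c ^ 2) in H.
2:{ rewrite Hx. apply Rmult_eq_reg_r with (c ^ 2); [|lra]. field_simplify; [|lra|lra]. lra. }
assert (Hp : 0 < c ^ (2 * m + 8)) by (apply pow_lt; lra).
apply (Rmult_le_compat_l (c ^ (2 * m + 8))) in H; [|lra].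
rewrite <- (Rabs_pos_eq (c ^ (2 * m + 8))) in H at 1 by lra.
rewrite <- Rabs_mult in H.
assert (hcn : c <> 0) by lra.
eapply Rle_trans; [|eapply Rle_trans; [exact H|]].
- apply Req_le. f_equal. rewrite Rmult_minus_distr_l. f_equal.
  + rewrite Rpow_mult_distr. rewrite pow_inv, <- pow_mult.
    replace (2 * (m + 5))%nat with (2 * m + 8 + 2)%nat by lia.
    rewrite (pow_add _ _ 2). field. split; [|apply pow_nonzero]; lra.
  + unfold laplace_kernel. rewrite Hx, !pow_add. field. lra.
- apply Req_le. unfold laplace_error. rewrite Hx, !pow_add. field. lra.
Qed.

Lemma is_RInt_laplace_kernel j m :
  is_RInt (fun x => laplace_kernel j m (sin x) (cos x)) 0 (PI / 2)
   (wallis 0 (2 * m + 8) * (1 - 2 / 5 * INR j ^ 2 / (2 * INR m + 7)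
      - 58 / 25 * INR (m + 5) / ((2 * INR m + 7) * (2 * INR m + 5)))).
Proof.
assert (hm := pos_INR m).
assert (W1 := wallis_S 0 (2 * m + 6)). assert (W2 := wallis_S 1 (2 * m + 4)).
rewrite plus_INR, mult_INR in W1, W2. simpl INR in W1, W2.
replace (S (S (2 * m + 6))) with (2 * m + 8)%nat in W1 by lia.
replace (S (S (2 * m + 4))) with (2 * m + 6)%nat in W2 by lia.
set (w := wallis 0 (2 * m + 8)) in *.
assert (E1 : wallis 1 (2 * m + 6) = w / (2 * INR m + 7)).
{ apply Rmult_eq_reg_l with (2 * INR m + 7); [|lra]. field_simplify; lra. }
assert (E2 : wallis 2 (2 * m + 4) = 3 * w / ((2 * INR m + 7) * (2 * INR m + 5))).
{ apply Rmult_eq_reg_l with (2 * INR m + 5); [|lra].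
  transitivity (3 * wallis 1 (2 * m + 6)); [lra|]. rewrite E1. field. lra. }
assert (H := is_RInt_Rminus _ _ _ _ _ _ (is_RInt_Rminus _ _ _ _ _ _
  (is_RInt_wallis 0 (2 * m + 8))
  (is_RInt_Rscal _ (2 / 5 * INR j ^ 2) _ _ _ (is_RInt_wallis 1 (2 * m + 6))))
  (is_RInt_Rscal _ (58 / 75 * INR (m + 5)) _ _ _ (is_RInt_wallis 2 (2 * m + 4)))).
fold w in H. rewrite E1, E2 in H.
replace (w * _) with (w - 2 / 5 * INR j ^ 2 * (w / (2 * INR m + 7)) -
     58 / 75 * INR (m + 5) * (3 * w / ((2 * INR m + 7) * (2 * INR m + 5)))) by (field; lra).
eapply is_RInt_ext; [|exact H].
intros x _. unfold laplace_kernel. cbv beta.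
change (2 * 0)%nat with 0%nat; change (2 * 1)%nat with 2%nat; change (2 * 2)%nat with 4%nat.
as_R_equation. field.
Qed.

(** The offset [n = m + 5] keeps the lowest cosine exponent [2n - 10] a natural number. From
    [4 <= m] follows [n <= 2m + 1], the smallest divisor met, so each use of [wallis_S] gains a
    factor [1/n]. The three terms add up to [197.376], rounded to [200]. *)
Lemma is_RInt_laplace_error m :
  (4 <= m)%nat ->
  exists l, is_RInt (fun x => laplace_error m (sin x) (cos x)) 0 (PI / 2) l /\
    l <= wallis 0 (2 * m + 8) * (200 / INR (m + 5) ^ 2).
Proof.
intros Hm.
assert (hm : 4 <= INR m) by (replace 4 with (INR 4) by (simpl; ring); now apply le_INR).
assert (W1 := wallis_S 0 (2 * m + 6)). assert (W2 := wallis_S 1 (2 * m + 4)).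
assert (W3 := wallis_S 2 (2 * m + 2)). assert (W4 := wallis_S 3 (2 * m)).
rewrite plus_INR, mult_INR in W1, W2, W3. rewrite mult_INR in W4. simpl INR in W1, W2, W3, W4.
replace (S (S (2 * m + 6))) with (2 * m + 8)%nat in W1 by lia.
replace (S (S (2 * m + 4))) with (2 * m + 6)%nat in W2 by lia.
replace (S (S (2 * m + 2))) with (2 * m + 4)%nat in W3 by lia.
replace (S (S (2 * m))) with (2 * m + 2)%nat in W4 by lia.
assert (hw := wallis_0_pos (2 * m + 8)).
set (w := wallis 0 (2 * m + 8)) in *.
assert (Hn : INR (m + 5) = INR m + 5) by (rewrite plus_INR; simpl; ring).
set (n := INR (m + 5)) in *.
assert (hn : 9 <= n) by lra.
assert (step : forall a b d q B, d * a = q * b -> n <= d -> 0 <= q -> 0 <= b <= B ->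
    0 <= a <= q * B / n).
{ intros a b d q B Hab Hd Hq [Hb1 Hb2]. assert (0 <= q * b <= q * B) by (split; nra).
  assert (0 <= a) by nra. split; [assumption|].
  apply Rmult_le_reg_r with n; [lra|]. unfold Rdiv. rewrite Rmult_assoc, Rinv_l by lra. nra. }
assert (S1 := step (wallis 1 (2 * m + 6)) w (2 * INR m + 7) 1 w ltac:(lra) ltac:(lra) ltac:(lra) ltac:(lra)).
assert (S2 := step (wallis 2 (2 * m + 4)) (wallis 1 (2 * m + 6)) (2 * INR m + 5) 3 _ ltac:(lra) ltac:(lra) ltac:(lra) S1).
assert (S3 := step (wallis 3 (2 * m + 2)) (wallis 2 (2 * m + 4)) (2 * INR m + 3) 5 _ ltac:(lra) ltac:(lra) ltac:(lra) S2).
assert (S4 := step (wallis 4 (2 * m)) (wallis 3 (2 * m + 2)) (2 * INR m + 1) 7 _ ltac:(lra) ltac:(lra) ltac:(lra) S3).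
replace (3 * (1 * w / n) / n) with (3 * w / n ^ 2) in S2 by (field; lra).
replace (5 * (3 * (1 * w / n) / n) / n) with (15 * w / n ^ 3) in S3 by (field; lra).
replace (7 * (5 * (3 * (1 * w / n) / n) / n) / n) with (105 * w / n ^ 4) in S4 by (field; lra).
eexists. split.
- eapply is_RInt_ext; [|exact (is_RInt_Rplus _ _ _ _ _ _ (is_RInt_Rplus _ _ _ _ _ _
  (is_RInt_Rscal _ (34 * (16 / 25)) _ _ _ (is_RInt_wallis 2 (2 * m + 4)))
  (is_RInt_Rscal _ (6 * n * (64 / 125)) _ _ _ (is_RInt_wallis 3 (2 * m + 2))))
  (is_RInt_Rscal _ (2 * n ^ 2 * (256 / 625)) _ _ _ (is_RInt_wallis 4 (2 * m))))].
  intros x _. unfold laplace_error. fold n. cbv beta.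
  change (2 * 2)%nat with 4%nat; change (2 * 3)%nat with 6%nat; change (2 * 4)%nat with 8%nat.
  as_R_equation. field.
- apply Rle_trans with (34 * (16 / 25) * (3 * w / n ^ 2) + 6 * n * (64 / 125) * (15 * w / n ^ 3)
    + 2 * n ^ 2 * (256 / 625) * (105 * w / n ^ 4)).
  + repeat apply Rplus_le_compat; apply Rmult_le_compat_l; try lra; nra.
  + assert (0 <= w / n ^ 2) by (apply Rdiv_le_0_compat; [lra|apply pow_lt; lra]).
    replace (_ + _ + _) with (w / n ^ 2 * (34 * (16 / 25) * 3 + 6 * (64 / 125) * 15 + 2 * (256 / 625) * 105))
      by (field; lra).
    replace (w * (200 / n ^ 2)) with (w / n ^ 2 * 200) by (field; lra).
    apply Rmult_le_compat_l; lra.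
Qed.

Lemma trig_bulk_region x : 0 <= x <= atan (sqrt 5 / 4) ->
  0 < cos x /\ 0 <= sin x /\ 16 * sin x ^ 2 <= 5 * cos x ^ 2.
Proof.
intros Hx. assert (hb := atan_bound (sqrt 5 / 4)).
assert (hc : 0 < cos x) by (apply cos_gt_0; lra).
assert (hs : 0 <= sin x) by (apply sin_ge_0; lra).
split; [exact hc|split; [exact hs|]].
assert (ht : tan x <= sqrt 5 / 4).
{ destruct (Req_dec x (atan (sqrt 5 / 4))) as [->|Hne]; [rewrite tan_atan; lra|].
  rewrite <- (tan_atan (sqrt 5 / 4)). apply Rlt_le, tan_increasing; lra. }
assert (h5 : sqrt 5 * sqrt 5 = 5) by (apply sqrt_sqrt; lra).
assert (sqrt 5 >= 0) by (apply Rle_ge, sqrt_pos).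
assert (hs' : sin x = tan x * cos x) by (unfold tan; field; lra).
assert (hl : sin x <= sqrt 5 / 4 * cos x) by (rewrite hs'; apply Rmult_le_compat_r; lra).
assert (sin x * sin x <= (sqrt 5 / 4 * cos x) * (sqrt 5 / 4 * cos x)) by (apply Rmult_le_compat; lra).
replace ((sqrt 5 / 4 * cos x) * (sqrt 5 / 4 * cos x)) with (sqrt 5 * sqrt 5 / 16 * cos x ^ 2) in H0 by field.
rewrite h5 in H0. simpl. lra.
Qed.

Lemma trig_tail_region x : atan (sqrt 5 / 4) <= x <= PI / 2 -> 5 * cos x ^ 2 <= 16 * sin x ^ 2.
Proof.
intros Hx. assert (hb := atan_bound (sqrt 5 / 4)).
assert (h5 : sqrt 5 * sqrt 5 = 5) by (apply sqrt_sqrt; lra).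
assert (sqrt 5 >= 0) by (apply Rle_ge, sqrt_pos).
destruct (Req_dec x (PI / 2)) as [->|Hne]; [rewrite cos_PI2, sin_PI2; lra|].
assert (hc : 0 < cos x) by (apply cos_gt_0; lra).
assert (ht : sqrt 5 / 4 <= tan x).
{ destruct (Req_dec x (atan (sqrt 5 / 4))) as [->|Hne']; [rewrite tan_atan; lra|].
  rewrite <- (tan_atan (sqrt 5 / 4)) at 1. apply Rlt_le, tan_increasing; lra. }
assert (hs' : sin x = tan x * cos x) by (unfold tan; field; lra).
assert (hl : sqrt 5 / 4 * cos x <= sin x) by (rewrite hs'; apply Rmult_le_compat_r; lra).
assert ((sqrt 5 / 4 * cos x) * (sqrt 5 / 4 * cos x) <= sin x * sin x) by (apply Rmult_le_compat; nra).
replace ((sqrt 5 / 4 * cos x) * (sqrt 5 / 4 * cos x)) with (sqrt 5 * sqrt 5 / 16 * cos x ^ 2) in H0 by field.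
rewrite h5 in H0. simpl in *. lra.
Qed.

(** The angle [ph] corresponds to [x = 1/2]. Up to [ph] the integrand is compared with the kernel;
    beyond it the kernel alone is bounded by the error, which completes both integrals to
    [PI / 2]. *)
Lemma laplace_bulk j m : (j <= 3)%nat -> (4 <= m)%nat ->
  Rabs (RInt (fun x => (symb x / 4) ^ (m + 5) * cos (INR j * x)) 0 (1 / 2)
   - 2 / sqrt 5 * (wallis 0 (2 * m + 8) * (1 - 2 / 5 * INR j ^ 2 / (2 * INR m + 7)
      - 58 / 25 * INR (m + 5) / ((2 * INR m + 7) * (2 * INR m + 5)))))
  <= wallis 0 (2 * m + 8) * (200 / INR (m + 5) ^ 2).
Proof.
intros Hj Hm.
set (f := fun x => (symb x / 4) ^ (m + 5) * cos (INR j * x)).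
set (g := fun x => 2 / sqrt 5 * (sin x / cos x)).
set (ph := atan (sqrt 5 / 4)).
assert (h5 : 0 < sqrt 5) by (apply sqrt_lt_R0; lra).
assert (hb := atan_bound (sqrt 5 / 4)). fold ph in hb.
assert (hp0 : 0 <= ph).
{ unfold ph. rewrite <- atan_0. destruct (Req_dec (sqrt 5 / 4) 0); [lra|]. apply Rlt_le, atan_increasing. lra. }
assert (Hf : forall x, ex_derive f x) by (intros x; unfold f, symb; auto_derive; auto).
set (F := fun x => f (g x) / cos x ^ 2).
assert (HF : is_RInt F 0 ph (sqrt 5 / 2 * RInt f 0 (1 / 2))).
{ replace (RInt f 0 (1 / 2)) with (RInt f (g 0) (g ph)).
  2:{ f_equal; unfold g.
      - rewrite sin_0. unfold Rdiv. ring.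
      - change (sin ph / cos ph) with (tan ph). unfold ph. rewrite tan_atan. field. lra. }
  rewrite <- (RInt_comp (V := R_CompleteNormedModule) f g (fun x => 2 / sqrt 5 * / cos x ^ 2)).
  - apply (is_RInt_ext (fun x => sqrt 5 / 2 * (2 / sqrt 5 * / cos x ^ 2 * f (g x)))).
    { intros x Hx. rewrite Rmin_left, Rmax_right in Hx by lra.
      destruct (trig_bulk_region x) as [hc _]; [unfold ph in Hx; lra|]. unfold F. as_R_equation. field. lra. }
    apply is_RInt_Rscal. apply (@RInt_correct R_CompleteNormedModule).
    apply (@ex_RInt_continuous R_CompleteNormedModule). intros x Hx.
    rewrite Rmin_left, Rmax_right in Hx by lra.
    destruct (trig_bulk_region x) as [hc _]; [unfold ph in Hx; lra|].
    apply (ex_derive_continuous (V := R_NormedModule) (fun y => 2 / sqrt 5 * / cos y ^ 2 * f (g y))).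
    unfold f, g, symb. auto_derive. repeat split; try lra. nra.
  - intros x _. apply (ex_derive_continuous (V := R_NormedModule)). apply Hf.
  - intros x Hx. rewrite Rmin_left, Rmax_right in Hx by lra.
    destruct (trig_bulk_region x) as [hc _]; [unfold ph in Hx; lra|]. split.
    + unfold g. auto_derive; [lra|].
      assert (E := sin2_cos2 x). unfold Rsqr in E.
      replace (2 / sqrt 5 * / cos x ^ 2) with (2 / sqrt 5 * ((sin x * sin x + cos x * cos x) * / cos x ^ 2)) by (rewrite E; ring).
      field. lra.
    + apply (ex_derive_continuous (V := R_NormedModule)). auto_derive. nra. }
destruct (is_RInt_laplace_error m Hm) as [le [HE HEle]].
assert (HK := is_RInt_laplace_kernel j m).
set (k := _ * (1 - _ - _)) in *.
set (kern := fun x => laplace_kernel j m (sin x) (cos x)) in *.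
set (err := fun x => laplace_error m (sin x) (cos x)) in *.
assert (Dk : forall x, ex_derive kern x) by (intros x; unfold kern, laplace_kernel; auto_derive; auto).
assert (De : forall x, ex_derive err x) by (intros x; unfold err, laplace_error; auto_derive; auto).
assert (Ck : forall a b, is_RInt kern a b (RInt kern a b)).
{ intros. apply (@RInt_correct R_CompleteNormedModule), ex_RInt_derivable, Dk. }
assert (Ce : forall a b, is_RInt err a b (RInt err a b)).
{ intros. apply (@RInt_correct R_CompleteNormedModule), ex_RInt_derivable, De. }
assert (Ek : k = RInt kern 0 ph + RInt kern ph (PI / 2)).
{ rewrite <- (is_RInt_Runique _ _ _ _ HK). symmetry.
  apply (RInt_Chasles (V := R_CompleteNormedModule)); apply ex_RInt_derivable, Dk. }
assert (Ee : le = RInt err 0 ph + RInt err ph (PI / 2)).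
{ rewrite <- (is_RInt_Runique _ _ _ _ HE). symmetry.
  apply (RInt_Chasles (V := R_CompleteNormedModule)); apply ex_RInt_derivable, De. }
assert (B1 : Rabs (sqrt 5 / 2 * RInt f 0 (1 / 2) - RInt kern 0 ph) <= RInt err 0 ph).
{ apply (norm_RInt_le (V := R_NormedModule) (fun x => F x - kern x) err 0 ph); [lra| | |apply Ce].
  - intros x Hx. destruct (trig_bulk_region x Hx) as [hc [hs hr]].
    assert (E := sin2_cos2 x). unfold Rsqr in E.
    apply (laplace_kernel_bulk j m (sin x) (cos x) Hj hc); simpl in *; lra.
  - apply is_RInt_Rminus; [exact HF|apply Ck]. }
assert (B2 : Rabs (RInt kern ph (PI / 2)) <= RInt err ph (PI / 2)).
{ apply (norm_RInt_le (V := R_NormedModule) kern err ph (PI / 2)); [lra| |apply Ck|apply Ce].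
  intros x Hx. apply (laplace_kernel_tail j m (sin x) (cos x) Hj). apply trig_tail_region. exact Hx. }
assert (B3 : Rabs (sqrt 5 / 2 * RInt f 0 (1 / 2) - k) <= le).
{ rewrite Ek, Ee. replace (_ - _) with ((sqrt 5 / 2 * RInt f 0 (1 / 2) - RInt kern 0 ph) + - RInt kern ph (PI / 2)) by ring.
  eapply Rle_trans; [apply Rabs_triang|]. rewrite Rabs_Ropp. lra. }
replace (RInt f 0 (1 / 2) - 2 / sqrt 5 * k) with (2 / sqrt 5 * (sqrt 5 / 2 * RInt f 0 (1 / 2) - k)) by (field; lra).
rewrite Rabs_mult. assert (h2 : 2 <= sqrt 5).
{ replace 2 with (sqrt (2 * 2)) by (apply sqrt_square; lra). apply sqrt_le_1; lra. }
assert (h25 : 0 <= 2 / sqrt 5 <= 1).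
{ split; [apply Rdiv_le_0_compat; lra|]. apply Rmult_le_reg_r with (sqrt 5); [lra|].
  unfold Rdiv. rewrite Rmult_assoc, Rinv_l by lra. lra. }
rewrite (Rabs_pos_eq (2 / sqrt 5)) by lra.
assert (hab := Rabs_pos (sqrt 5 / 2 * RInt f 0 (1 / 2) - k)). nra.
Qed.

(** In [c = cos x] the quotient is [(2 c^2 + c - 1) / 2], at least [-9/16], and about [0.71] at
    [c = cos (1/2)]. *)
Lemma symb_tail x : 1 / 2 <= x <= PI -> Rabs (symb x / 4) <= 3 / 4.
Proof.
intros Hx. destruct (cos_taylor_2_4 (1 / 2)) as [_ h]; [lra|].
assert (hc : cos x <= cos (1 / 2)) by (apply cos_decr_1; lra).
assert (hb := COS_bound x). unfold symb. rewrite cos_2a_cos.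
apply Rabs_le. split; nra.
Qed.

(** Bernoulli gives [n / 10 <= 1.1^n], and [1.1^3 * 3/4 < 1]. The cube leaves room for the later
    factor [sqrt n]. *)
Lemma pow_three_quarters n : (1 <= n)%nat -> (3 / 4) ^ n <= 1000 / INR n ^ 3.
Proof.
intros Hn. assert (h : 1 <= INR n) by (replace 1 with (INR 1) by reflexivity; now apply le_INR).
assert (hp := poly n (1 / 10)).
assert (h1 : INR n / 10 <= (11 / 10) ^ n) by (replace (11 / 10) with (1 + 1 / 10) by field; lra).
assert (h2 : (INR n / 10) ^ 3 <= ((11 / 10) ^ n) ^ 3) by (apply pow_incr; lra).
assert (h3 : (3 / 4) ^ n * ((11 / 10) ^ n) ^ 3 <= 1).
{ rewrite <- pow_mult, Nat.mul_comm, pow_mult, <- Rpow_mult_distr.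
  rewrite <- (pow1 n). apply pow_incr. lra. }
assert (h4 : 0 < (3 / 4) ^ n) by (apply pow_lt; lra).
apply Rmult_le_reg_r with (INR n ^ 3); [apply pow_lt; lra|].
unfold Rdiv at 2. rewrite Rmult_assoc, Rinv_l by (apply pow_nonzero; lra).
replace (INR n ^ 3) with (1000 * (INR n / 10) ^ 3) by field.
nra.
Qed.

Lemma laplace_total j m : (j <= 3)%nat -> (4 <= m)%nat ->
  Rabs (trig_moment symb (m + 5) j / 4 ^ (m + 5)
   - 2 / (sqrt 5 * PI) * (wallis 0 (2 * m + 8) * (1 - 2 / 5 * INR j ^ 2 / (2 * INR m + 7)
      - 58 / 25 * INR (m + 5) / ((2 * INR m + 7) * (2 * INR m + 5)))))
  <= wallis 0 (2 * m + 8) * (200 / INR (m + 5) ^ 2) + 1000 / INR (m + 5) ^ 3.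
Proof.
intros Hj Hm.
assert (hb := laplace_bulk j m Hj Hm).
set (n := (m + 5)%nat) in *. set (k := wallis 0 _ * (1 - _ - _)) in *.
set (f := fun x => (symb x / 4) ^ n * cos (INR j * x)) in *.
assert (Hf : forall x, ex_derive f x) by (intros x; unfold f, symb; auto_derive; auto).
assert (hPI := PI2_3_2). assert (hPI4 := PI_4).
assert (h5 : 0 < sqrt 5) by (apply sqrt_lt_R0; lra).
assert (E : trig_moment symb n j / 4 ^ n = / PI * (RInt f 0 (1 / 2) + RInt f (1 / 2) PI)).
{ unfold trig_moment. unfold Rdiv. rewrite Rmult_assoc. f_equal.
  transitivity (RInt f 0 PI).
  - apply Rmult_eq_reg_l with (4 ^ n); [|apply pow_nonzero; lra].
    rewrite (Rmult_comm (RInt _ _ _)), <- Rmult_assoc, Rinv_r, Rmult_1_l by (apply pow_nonzero; lra).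
    apply is_RInt_Runique. eapply is_RInt_ext.
    2: apply is_RInt_Rscal; apply (@RInt_correct R_CompleteNormedModule), ex_RInt_derivable, Hf.
    intros x _. unfold f. cbv beta. rewrite <- Rmult_assoc, <- Rpow_mult_distr.
    replace (4 * (symb x / 4)) with (symb x) by field. reflexivity.
  - symmetry. apply (RInt_Chasles (V := R_CompleteNormedModule)); apply ex_RInt_derivable, Hf. }
assert (T : Rabs (RInt f (1 / 2) PI) <= PI * (3 / 4) ^ n).
{ eapply Rle_trans.
  - apply (norm_RInt_le (V := R_NormedModule) f (fun _ => (3 / 4) ^ n) (1 / 2) PI); [lra| | |].
    + intros x Hx. change (Rabs (f x) <= (3 / 4) ^ n). unfold f.
      rewrite Rabs_mult, <- RPow_abs.
      assert (h := symb_tail x Hx). assert (Rabs (cos (INR j * x)) <= 1) by (apply Rabs_le, COS_bound).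
      assert (Rabs (symb x / 4) ^ n <= (3 / 4) ^ n) by (apply pow_incr; split; [apply Rabs_pos|exact h]).
      assert (0 <= Rabs (symb x / 4) ^ n) by (apply pow_le, Rabs_pos).
      assert (0 <= Rabs (cos (INR j * x))) by apply Rabs_pos. nra.
    + apply (@RInt_correct R_CompleteNormedModule), ex_RInt_derivable, Hf.
    + apply (is_RInt_const (V := R_NormedModule)).
  - change ((PI - 1 / 2) * (3 / 4) ^ n <= PI * (3 / 4) ^ n).
    assert (0 < (3 / 4) ^ n) by (apply pow_lt; lra). nra. }
assert (P := pow_three_quarters n).
rewrite E.
replace (_ - _) with (/ PI * ((RInt f 0 (1 / 2) - 2 / sqrt 5 * k) + RInt f (1 / 2) PI)) by (field; lra).
rewrite Rabs_mult, (Rabs_pos_eq (/ PI)) by (apply Rlt_le, Rinv_0_lt_compat; lra).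
apply Rmult_le_reg_l with PI; [lra|]. rewrite <- Rmult_assoc, Rinv_r, Rmult_1_l by lra.
eapply Rle_trans; [apply Rabs_triang|].
assert (0 <= Rabs (RInt f 0 (1 / 2) - 2 / sqrt 5 * k)) by apply Rabs_pos.
assert (P' := P ltac:(unfold n; lia)).
assert (PI * (3 / 4) ^ n <= PI * (1000 / INR n ^ 3)) by (apply Rmult_le_compat_l; lra).
nra.
Qed.

(** * Second-order expansions *)

Definition expands (f : nat -> R) (A B : R) : Prop :=
  exists (K : R) (N : nat), forall n, (N <= n)%nat ->
    Rabs (f n - (A + B / INR n)) <= K / INR n ^ 2.

Lemma INR_ge_1 n N : (S N <= n)%nat -> 1 <= INR n.
Proof. intros H. replace 1 with (INR 1) by reflexivity. apply le_INR. lia. Qed.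

Lemma expands_perturb f g A B K N :
  expands g A B ->
  (forall n, (N <= n)%nat -> Rabs (f n - g n) <= K / INR n ^ 2) ->
  expands f A B.
Proof.
intros [L [M H]] Hfg. exists (K + L), (N + M)%nat. intros n Hn.
specialize (H n ltac:(lia)). specialize (Hfg n ltac:(lia)).
replace (f n - _) with ((f n - g n) + (g n - (A + B / INR n))) by ring.
eapply Rle_trans; [apply Rabs_triang|]. unfold Rdiv in *. lra.
Qed.

Lemma expands_ext f g A B N :
  expands g A B -> (forall n, (N <= n)%nat -> f n = g n) -> expands f A B.
Proof.
intros H Hfg. apply (expands_perturb f g A B 0 N H). intros n Hn.
rewrite Hfg, Rminus_diag, Rabs_R0 by exact Hn. unfold Rdiv. lra.
Qed.

Lemma expands_eq f A B A' B' : expands f A B -> A = A' -> B = B' -> expands f A' B'.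
Proof. now intros H <- <-. Qed.

Lemma expands_const c : expands (fun _ => c) c 0.
Proof.
exists 0, 0%nat. intros n _. unfold Rdiv. rewrite !Rmult_0_l, Rplus_0_r, Rminus_diag, Rabs_R0. lra.
Qed.

Lemma expands_plus f g A B C D :
  expands f A B -> expands g C D -> expands (fun n => f n + g n) (A + C) (B + D).
Proof.
intros [K [N Hf]] [L [M Hg]]. exists (K + L), (N + M)%nat. intros n Hn.
specialize (Hf n ltac:(lia)). specialize (Hg n ltac:(lia)).
replace (_ - _) with ((f n - (A + B / INR n)) + (g n - (C + D / INR n))) by (unfold Rdiv; ring).
eapply Rle_trans; [apply Rabs_triang|]. unfold Rdiv in *. lra.
Qed.

Lemma expands_mult f g A B C D :
  expands f A B -> expands g C D ->
  expands (fun n => f n * g n) (A * C) (A * D + B * C).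
Proof.
intros [K [N Hf]] [L [M Hg]].
exists (Rabs B * Rabs D + (Rabs A + Rabs B) * Rabs L + (Rabs C + Rabs D) * Rabs K + Rabs K * Rabs L), (S (N + M)).
intros n Hn. assert (h1 := INR_ge_1 n _ Hn).
specialize (Hf n ltac:(lia)). specialize (Hg n ltac:(lia)).
set (x := INR n) in *. set (r := f n - (A + B / x)) in *. set (s := g n - (C + D / x)) in *.
set (y := / x).
assert (hy : 0 < y <= 1).
{ unfold y. split; [apply Rinv_0_lt_compat; lra|]. rewrite <- Rinv_1. apply Rinv_le_contravar; lra. }
assert (hy2 : / x ^ 2 = y ^ 2) by (unfold y; field; lra).
replace (f n * g n - _) with (B * D * y ^ 2 + (A + B * y) * s + (C + D * y) * r + r * s)
  by (unfold r, s, y; field; lra).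
unfold Rdiv in Hf, Hg |- *. rewrite hy2 in Hf, Hg |- *.
assert (hyy : 0 <= y ^ 2 <= 1) by nra.
assert (Hr : Rabs r <= Rabs K * y ^ 2) by (assert (h := Rle_abs K); nra).
assert (Hs : Rabs s <= Rabs L * y ^ 2) by (assert (h := Rle_abs L); nra).
assert (lin : forall U V, Rabs (U + V * y) <= Rabs U + Rabs V).
{ intros U V. eapply Rle_trans; [apply Rabs_triang|]. rewrite Rabs_mult, (Rabs_pos_eq y) by lra.
  assert (h := Rabs_pos V). nra. }
assert (lA := lin A B). assert (lC := lin C D).
assert (hK := Rabs_pos K). assert (hL := Rabs_pos L).
assert (T1 : Rabs (B * D * y ^ 2) <= Rabs B * Rabs D * y ^ 2).
{ rewrite !Rabs_mult, (Rabs_pos_eq (y ^ 2)) by lra. lra. }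
assert (T2 : Rabs ((A + B * y) * s) <= (Rabs A + Rabs B) * (Rabs L * y ^ 2)).
{ rewrite Rabs_mult. apply Rmult_le_compat; auto using Rabs_pos. }
assert (T3 : Rabs ((C + D * y) * r) <= (Rabs C + Rabs D) * (Rabs K * y ^ 2)).
{ rewrite Rabs_mult. apply Rmult_le_compat; auto using Rabs_pos. }
assert (T4 : Rabs (r * s) <= Rabs K * (Rabs L * y ^ 2)).
{ rewrite Rabs_mult. apply Rmult_le_compat; auto using Rabs_pos. nra. }
eapply Rle_trans; [apply Rabs_triang|]. eapply Rle_trans; [apply Rplus_le_compat_r, Rabs_triang|].
eapply Rle_trans; [apply Rplus_le_compat_r, Rplus_le_compat_r, Rabs_triang|]. lra.
Qed.

Lemma expands_scal c f A B : expands f A B -> expands (fun n => c * f n) (c * A) (c * B).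
Proof.
intros H. assert (E := expands_mult _ _ _ _ _ _ (expands_const c) H).
now rewrite Rmult_0_l, Rplus_0_r in E.
Qed.

Lemma expands_inv_2n_sub_3 : expands (fun n => / (2 * INR n - 3)) 0 (1 / 2).
Proof.
exists 3, 3%nat. intros n Hn. assert (h : 3 <= INR n) by (replace 3 with (INR 3) by (simpl; ring); now apply le_INR).
set (x := INR n) in *.
replace (_ - _) with (3 / (2 * x * (2 * x - 3))) by (field; lra).
rewrite Rabs_pos_eq by (apply Rdiv_le_0_compat; nra).
unfold Rdiv. apply Rmult_le_compat_l; [lra|]. apply Rinv_le_contravar; nra.
Qed.

Lemma expands_quartic_ratio :
  expands (fun n => INR n / ((2 * INR n - 3) * (2 * INR n - 5))) 0 (1 / 4).
Proof.
exists 16, 5%nat. intros n Hn. assert (h : 5 <= INR n) by (replace 5 with (INR 5) by (simpl; ring); now apply le_INR).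
set (x := INR n) in *.
replace (_ - _) with ((16 * x - 15) / (4 * x * (2 * x - 3) * (2 * x - 5))) by (field; lra).
assert (0 < 4 * x * (2 * x - 3) * (2 * x - 5)) by (repeat apply Rmult_lt_0_compat; lra).
rewrite Rabs_pos_eq by (apply Rdiv_le_0_compat; lra).
apply Rminus_le_0.
replace (_ - _) with ((64 * (2 * x - 3) * (2 * x - 5) - (16 * x - 15) * x) / (x * (4 * x * (2 * x - 3) * (2 * x - 5))))
  by (field; lra).
apply Rdiv_le_0_compat; nra.
Qed.

Lemma expands_2n_ratio : expands (fun n => 2 * INR n / (2 * INR n - 1)) 1 (1 / 2).
Proof.
exists 1, 1%nat. intros n Hn. assert (h := INR_ge_1 n _ Hn). set (x := INR n) in *.
replace (_ - _) with (1 / (2 * x * (2 * x - 1))) by (field; lra).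
rewrite Rabs_pos_eq by (apply Rdiv_le_0_compat; nra).
unfold Rdiv. apply Rmult_le_compat_l; [lra|]. apply Rinv_le_contravar; nra.
Qed.

Lemma expands_n_ratio : expands (fun n => INR n / (INR n + 1)) 1 (-1).
Proof.
exists 1, 1%nat. intros n Hn. assert (h := INR_ge_1 n _ Hn). set (x := INR n) in *.
replace (_ - _) with (1 / (x * (x + 1))) by (field; lra).
rewrite Rabs_pos_eq by (apply Rdiv_le_0_compat; nra).
unfold Rdiv. apply Rmult_le_compat_l; [lra|]. apply Rinv_le_contravar; nra.
Qed.

(** The difference of [y] and its approximation [b] is read off from [y^2 - b^2], divided by
    [y + b >= sqrt PI / 4]. *)
Lemma expands_wallis_even :
  expands (fun n => sqrt (INR n) * wallis 0 (2 * n)) (sqrt PI / 2) (- (sqrt PI / 16)).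
Proof.
exists (sqrt PI), 1%nat. intros n Hn. assert (h := INR_ge_1 n _ Hn).
assert (hPI := PI_RGT_0).
assert (U := wallis_even_sqr_upper n).
assert (L : PI / 4 <= wallis 0 (2 * n) ^ 2 * (INR n + (1 / 4 + 1 / (32 * INR n)))).
{ destruct n as [|n]; [lia|]. apply wallis_even_sqr_lower. }
assert (hw := wallis_0_pos (2 * n)).
set (w := wallis 0 (2 * n)) in *. set (x := INR n) in *.
assert (hx : sqrt x ^ 2 = x) by (apply pow2_sqrt; lra).
assert (hp : sqrt PI ^ 2 = PI) by (apply pow2_sqrt; lra).
assert (sx : 0 < sqrt x) by (apply sqrt_lt_R0; lra).
assert (sp : 0 < sqrt PI) by (apply sqrt_lt_R0; lra).
set (p := sqrt PI) in *. set (y := sqrt x * w).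
assert (hy2 : y ^ 2 = x * w ^ 2) by (unfold y; rewrite Rpow_mult_distr, hx; ring).
assert (hy : 0 < y) by (unfold y; apply Rmult_lt_0_compat; lra).
set (b := p / 2 * (1 - 1 / (8 * x))).
replace (p / 2 + - (p / 16) / x) with b by (unfold b; field; lra).
assert (hi : 0 < 1 / x <= 1).
{ split; [apply Rdiv_lt_0_compat; lra|]. apply Rmult_le_reg_r with x; [lra|]. unfold Rdiv.
  rewrite Rmult_assoc, Rinv_l; lra. }
assert (hb : p / 4 <= b).
{ unfold b. replace (1 / (8 * x)) with (1 / x / 8) by (field; lra). nra. }
assert (hb2 : b ^ 2 = PI / 4 * (1 - 1 / (8 * x)) ^ 2) by (unfold b; rewrite <- hp; field; lra).
assert (D : Rabs (y ^ 2 - b ^ 2) <= PI / 4 * (1 / x ^ 2)).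
{ rewrite hy2, hb2.
  assert (U' : x * w ^ 2 <= PI / 4 * (x / (x + 1 / 4))).
  { apply Rmult_le_reg_r with (x + 1 / 4); [lra|].
    replace (PI / 4 * (x / (x + 1 / 4)) * (x + 1 / 4)) with (x * (PI / 4)) by (field; lra).
    rewrite Rmult_assoc. apply Rmult_le_compat_l; lra. }
  assert (hz : 0 < x + (1 / 4 + 1 / (32 * x))) by (replace (1 / (32 * x)) with (1 / x / 32) by (field; lra); lra).
  assert (L' : PI / 4 * (x / (x + (1 / 4 + 1 / (32 * x)))) <= x * w ^ 2).
  { apply Rmult_le_reg_r with (x + (1 / 4 + 1 / (32 * x))); [lra|].
    replace (PI / 4 * (x / (x + (1 / 4 + 1 / (32 * x)))) * (x + (1 / 4 + 1 / (32 * x)))) with (x * (PI / 4)) by (field; nra).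
    rewrite Rmult_assoc. apply Rmult_le_compat_l; lra. }
  assert (U2 : x / (x + 1 / 4) - (1 - 1 / (8 * x)) ^ 2 <= 1 / x ^ 2).
  { apply Rminus_le_0.
    replace (_ - _) with ((65 * (4 * x + 1) - 16 * x) / (64 * x ^ 2 * (4 * x + 1))) by (field; lra).
    apply Rdiv_le_0_compat; [lra|]. apply Rmult_lt_0_compat; nra. }
  assert (L2 : - (1 / x ^ 2) <= x / (x + (1 / 4 + 1 / (32 * x))) - (1 - 1 / (8 * x)) ^ 2).
  { apply Rminus_le_0.
    replace (_ - _) with ((((64 * x ^ 2 - (8 * x - 1) ^ 2) * (32 * x ^ 2 + 8 * x + 1) - 64 * x ^ 2 * (8 * x + 1) + 64 * (32 * x ^ 2 + 8 * x + 1))) / (64 * x ^ 2 * (32 * x ^ 2 + 8 * x + 1))) by (field; nra).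
    apply Rdiv_le_0_compat; [nra|]. apply Rmult_lt_0_compat; nra. }
  apply Rabs_le. split; nra. }
assert (E : y ^ 2 - b ^ 2 = (y - b) * (y + b)) by ring.
rewrite E, Rabs_mult, (Rabs_pos_eq (y + b)) in D by lra.
assert (hab := Rabs_pos (y - b)).
assert (Rabs (y - b) * (p / 4) <= PI / 4 * (1 / x ^ 2)).
{ eapply Rle_trans; [|exact D]. apply Rmult_le_compat_l; lra. }
rewrite <- hp in H.
apply Rmult_le_reg_r with (p / 4); [lra|].
replace (p / x ^ 2 * (p / 4)) with (p ^ 2 / 4 * (1 / x ^ 2)) by (field; lra). exact H.
Qed.

Definition symb_constant : R := 2 / (sqrt 5 * PI) * (sqrt PI / 2).

(** The relative [1/n] terms are [-1/8] from the Wallis integral, [1/2] from passing from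
    [wallis 0 (2n - 2)] to [wallis 0 (2n)], and [-j^2/5] and [-58/100] from the kernel;
    [1/2 - 1/8 - 58/100 = -41/200]. *)
Lemma expands_trig_moment_symb j : (j <= 3)%nat ->
  expands (fun n => sqrt (INR n) * (trig_moment symb n j / 4 ^ n))
    symb_constant (- (symb_constant * (41 / 200 + INR j ^ 2 / 5))).
Proof.
intros Hj.
set (main := fun n => 2 / (sqrt 5 * PI) * (sqrt (INR n) * wallis 0 (2 * n) * (2 * INR n / (2 * INR n - 1))
   * (1 + (- (2 / 5 * INR j ^ 2)) * / (2 * INR n - 3)
        + (- (58 / 25)) * (INR n / ((2 * INR n - 3) * (2 * INR n - 5)))))).
assert (h5 : 0 < sqrt 5) by (apply sqrt_lt_R0; lra).
assert (hPI := PI_RGT_0).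
assert (Hmain : expands main symb_constant (- (symb_constant * (41 / 200 + INR j ^ 2 / 5)))).
{ assert (H := expands_scal (2 / (sqrt 5 * PI)) _ _ _ (expands_mult _ _ _ _ _ _
    (expands_mult _ _ _ _ _ _ expands_wallis_even expands_2n_ratio)
    (expands_plus _ _ _ _ _ _ (expands_plus _ _ _ _ _ _ (expands_const 1)
       (expands_scal (- (2 / 5 * INR j ^ 2)) _ _ _ expands_inv_2n_sub_3))
       (expands_scal (- (58 / 25)) _ _ _ expands_quartic_ratio)))).
  cbv beta in H.
  apply (expands_eq _ _ _ _ _ H); unfold symb_constant; field; lra. }
(* [1400 = 2 * 200 + 1000], using [sqrt n * wallis 0 (2n - 2) <= 2] and [sqrt n <= n]; the start [9]
   is [m >= 4] shifted by 5. *)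
apply (expands_perturb _ main _ _ 1400 9 Hmain).
intros n Hn. destruct (Nat.le_exists_sub 5 n) as [m [-> _]]; [lia|].
assert (Hm : (4 <= m)%nat) by lia.
assert (T := laplace_total j m Hj Hm).
assert (hm : 4 <= INR m) by (replace 4 with (INR 4) by (simpl; ring); now apply le_INR).
assert (U := wallis_even_sqr_upper (m + 4)).
assert (hw := wallis_0_pos (2 * m + 8)).
unfold main.
assert (W := wallis_even_S (m + 4)).
replace (S (m + 4)) with (m + 5)%nat in W by lia.
replace (2 * (m + 4))%nat with (2 * m + 8)%nat in U, W by lia.
assert (E4 : INR (m + 4) = INR (m + 5) - 1) by (rewrite !plus_INR; simpl; ring).
assert (E5 : INR m = INR (m + 5) - 5) by (rewrite plus_INR; simpl; ring).
rewrite E4 in U, W. rewrite E5 in T, hm.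
set (w := wallis 0 (2 * m + 8)) in *. set (x := INR (m + 5)) in *.
set (q := trig_moment symb (m + 5) j / 4 ^ (m + 5)) in *.
rewrite W.
assert (hx : sqrt x ^ 2 = x) by (apply pow2_sqrt; lra).
assert (sx : 0 < sqrt x) by (apply sqrt_lt_R0; lra).
assert (hsw : sqrt x * w <= 2).
{ assert (hPI4 := PI_4). assert ((sqrt x * w) ^ 2 <= 2 ^ 2).
  { rewrite Rpow_mult_distr, hx. assert (0 <= w ^ 2) by nra. nra. }
  apply Rsqr_incr_0_var; [|lra]. unfold Rsqr. lra. }
assert (hsx : sqrt x <= x) by nra.
replace (_ - _) with (sqrt x * (q - 2 / (sqrt 5 * PI) * (w * (1 - 2 / 5 * INR j ^ 2 / (2 * (x - 5) + 7)
   - 58 / 25 * x / ((2 * (x - 5) + 7) * (2 * (x - 5) + 5)))))) by (field; repeat split; lra).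
rewrite Rabs_mult, (Rabs_pos_eq (sqrt x)) by lra.
apply Rle_trans with (sqrt x * (w * (200 / x ^ 2) + 1000 / x ^ 3)).
{ apply Rmult_le_compat_l; lra. }
assert (hx3 : 0 < 1 / x ^ 2) by (apply Rdiv_lt_0_compat; [lra|apply pow_lt; lra]).
assert (hx4 : 0 <= 1000 / x ^ 3) by (apply Rdiv_le_0_compat; [lra|apply pow_lt; lra]).
apply Rle_trans with (2 * (200 / x ^ 2) + x * (1000 / x ^ 3)).
- assert (sqrt x * w * (200 * (1 / x ^ 2)) <= 2 * (200 * (1 / x ^ 2))) by (apply Rmult_le_compat_r; lra).
  assert (sqrt x * (1000 / x ^ 3) <= x * (1000 / x ^ 3)) by (apply Rmult_le_compat_r; lra).
  unfold Rdiv in *. lra.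
- apply Req_le. field. lra.
Qed.

(** Put [x = 2 y]: then [2 + 2 cos x = 4 cos^2 y] and [cos x = 2 cos^2 y - 1], leaving two even
    Wallis integrals in ratio [(2n + 1) / (2n + 2)]. *)
Lemma trig_moment_symb_lazy_1 n :
  trig_moment symb_lazy n 1 = 4 ^ n * (2 / PI * (wallis 0 (2 * n) * (INR n / (INR n + 1)))).
Proof.
assert (hPI := PI_RGT_0). assert (hn := pos_INR n).
assert (W := wallis_even_S n).
assert (H := is_RInt_Rscal _ (2 * 4 ^ n) _ _ _ (is_RInt_Rminus _ _ _ _ _ _
  (is_RInt_Rscal _ 2 _ _ _ (is_RInt_wallis 0 (2 * S n))) (is_RInt_wallis 0 (2 * n)))).
unfold trig_moment.
set (f := fun x => symb_lazy x ^ n * cos (INR 1 * x)).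
assert (Hf : forall x, ex_derive f x) by (intros x; unfold f, symb_lazy; auto_derive; auto).
assert (E : RInt f 0 PI = 2 * 4 ^ n * (2 * wallis 0 (2 * S n) - wallis 0 (2 * n))).
{ rewrite <- (is_RInt_Runique _ _ _ _ H).
  assert (RC := RInt_comp_lin (V := R_CompleteNormedModule) f 2 0 0 (PI / 2) (ex_RInt_derivable _ _ _ Hf)).
  replace (2 * 0 + 0) with 0 in RC by ring.
  replace (2 * (PI / 2) + 0) with PI in RC by field.
  rewrite <- RC.
  apply RInt_ext. intros x _. cbv beta. change (scal ?a ?b) with (a * b). as_R_equation.
  unfold f, symb_lazy. simpl INR. rewrite Rmult_1_l, Rplus_0_r, cos_2a_cos.
  replace (2 + 2 * (2 * cos x * cos x - 1)) with (4 * cos x ^ 2) by ring.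
  rewrite Rpow_mult_distr, <- pow_mult.
  replace (2 * S n)%nat with (2 * n + 2)%nat by lia. rewrite pow_add. simpl (2 * 0)%nat. ring. }
rewrite E, W. field. repeat split; lra.
Qed.

Lemma expands_trig_moment_symb_lazy :
  expands (fun n => sqrt (INR n) * (trig_moment symb_lazy n 1 / 4 ^ n))
    (/ sqrt PI) (- (9 / 8 / sqrt PI)).
Proof.
assert (hPI := PI_RGT_0).
assert (sp : 0 < sqrt PI) by (apply sqrt_lt_R0; lra).
assert (hp : sqrt PI * sqrt PI = PI) by (apply sqrt_sqrt; lra).
apply (expands_ext _ (fun n => 2 / PI * (sqrt (INR n) * wallis 0 (2 * n) * (INR n / (INR n + 1)))) _ _ 0).
- eapply expands_eq.
  + exact (expands_scal (2 / PI) _ _ _ (expands_mult _ _ _ _ _ _ expands_wallis_even expands_n_ratio)).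
  + rewrite <- hp at 1. field. lra.
  + rewrite <- hp at 1. field. lra.
- intros n _. rewrite trig_moment_symb_lazy_1. assert (h := pos_INR n). field.
  repeat split; try lra. apply pow_nonzero; lra.
Qed.

(** * Transfer to the walk counts *)

Lemma asymp_expansion_of_expands a A c :
  expands (fun n => a n * INR n * sqrt (INR n) / 4 ^ n) A (- (A * c)) ->
  asymp_expansion a A c.
Proof.
intros [K [N H]]. exists K, (S N). intros n Hn. specialize (H n ltac:(lia)).
assert (h := INR_ge_1 n _ Hn).
assert (h4 : 0 < 4 ^ n) by (apply pow_lt; lra).
set (x := INR n) in *.
assert (sx : 0 < sqrt x) by (apply sqrt_lt_R0; lra).
assert (hs : 0 < 4 ^ n / (x * sqrt x)) by (apply Rdiv_lt_0_compat; [lra|apply Rmult_lt_0_compat; lra]).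
replace (a n - _) with (4 ^ n / (x * sqrt x) * (a n * x * sqrt x / 4 ^ n - (A + - (A * c) / x)))
  by (field; repeat split; lra).
replace (K * _ / _) with (4 ^ n / (x * sqrt x) * (K / x ^ 2)) by (field; lra).
rewrite Rabs_mult, (Rabs_pos_eq (4 ^ n / (x * sqrt x))) by lra.
apply Rmult_le_compat_l; lra.
Qed.

Lemma INR_walks_1 n : INR n * INR (walks n 1) = trig_moment symb n 1.
Proof.
apply (walks_1_euler (trig_moment symb)).
- apply trig_moment_symb_S.
- apply trig_moment_0_0.
- apply trig_moment_0_S.
Qed.

Lemma INR_walks_2 n :
  INR n * (2 * INR (walks n 2) - INR (walks (S n) 1))
  = trig_moment symb_lazy n 1 - 3 * trig_moment symb n 3.
Proof.
apply (walks_2_euler (trig_moment symb) (trig_moment symb_lazy));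
  auto using trig_moment_symb_S, trig_moment_symb_lazy_S, trig_moment_0_0, trig_moment_0_S.
Qed.

Lemma symb_constant_eq : symb_constant = 1 / (sqrt 5 * sqrt PI).
Proof.
assert (sp : 0 < sqrt PI) by (apply sqrt_lt_R0, PI_RGT_0).
assert (s5 : 0 < sqrt 5) by (apply sqrt_lt_R0; lra).
assert (hp : sqrt PI * sqrt PI = PI) by (apply sqrt_sqrt, Rlt_le, PI_RGT_0).
unfold symb_constant. rewrite <- hp at 1. field. lra.
Qed.

Theorem theorem3p9 :
  asymp_expansion (fun n => INR (walks n 1%Z))
    (1 / sqrt (5 * PI)) (81 / 200) /\
  asymp_expansion (fun n => INR (walks n 2%Z))
    ((5 + sqrt 5) / (10 * sqrt PI)) ((201 + 24 * sqrt 5) / 200).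
Proof.
assert (hPI := PI_RGT_0).
assert (sp : 0 < sqrt PI) by (apply sqrt_lt_R0; lra).
assert (s5 : 0 < sqrt 5) by (apply sqrt_lt_R0; lra).
assert (h5 : sqrt 5 * sqrt 5 = 5) by (apply sqrt_sqrt; lra).
assert (EX := expands_trig_moment_symb).
split; apply asymp_expansion_of_expands.
- eapply expands_eq.
  + apply (expands_ext _ _ _ _ 0 (EX 1%nat ltac:(lia))).
    intros n _. rewrite <- INR_walks_1. unfold Rdiv. ring.
  + rewrite symb_constant_eq, sqrt_mult by lra. reflexivity.
  + rewrite symb_constant_eq, sqrt_mult by lra. simpl. field. lra.
- assert (H := expands_scal (1 / 2) _ _ _ (expands_plus _ _ _ _ _ _
    (expands_mult _ _ _ _ _ _ expands_n_ratio
      (expands_plus _ _ _ _ _ _ (expands_plus _ _ _ _ _ _ (expands_plus _ _ _ _ _ _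
        (EX 0%nat ltac:(lia)) (EX 1%nat ltac:(lia))) (EX 2%nat ltac:(lia))) (EX 3%nat ltac:(lia))))
    (expands_plus _ _ _ _ _ _ expands_trig_moment_symb_lazy (expands_scal (-3) _ _ _ (EX 3%nat ltac:(lia)))))).
  eapply expands_eq; [apply (expands_ext _ _ _ _ 0 H)|..].
  + intros n _. assert (hn := pos_INR n).
    (* One step of [T_refl] writes the moment at [n + 1] through those at [n], so neither
       [sqrt (n + 1)] nor [4^(n+1)] has to be expanded. *)
    assert (E1 := INR_walks_1 (S n)). rewrite trig_moment_symb_S, S_INR in E1. unfold T_refl in E1.
    assert (E2 := INR_walks_2 n).
    assert (h4 : 4 ^ n <> 0) by (apply pow_nonzero; lra).
    set (M0 := trig_moment symb n 0) in *. set (M1 := trig_moment symb n 1) in *.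
    set (M2 := trig_moment symb n 2) in *. set (M3 := trig_moment symb n 3) in *.
    set (L := trig_moment symb_lazy n 1) in *.
    assert (E1' : INR (walks (S n) 1) = (M0 + M1 + M2 + M3) / (INR n + 1)).
    { rewrite <- E1. field. lra. }
    assert (E : INR (walks n 2) * INR n = 1 / 2 * (INR n * ((M0 + M1 + M2 + M3) / (INR n + 1)) + (L - 3 * M3))).
    { rewrite <- E2, <- E1'. field. }
    rewrite E. field. lra.
  + rewrite symb_constant_eq. simpl. replace 10 with (2 * (sqrt 5 * sqrt 5)) by lra.
    replace (5 + sqrt 5) with (sqrt 5 * sqrt 5 + sqrt 5) by lra. field. lra.
  + rewrite symb_constant_eq. simpl.
    (* [225/200 = 9/8] comes from the lazy moment and [321/200 = 4 + 41/200 + 14/5 - 27/5] from the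
       others: the factor [n / (n + 1)], then [4 - 3] copies of [41/200], then the [j^2 / 5]
       terms. *)
    transitivity (- ((225 + 321 / sqrt 5) / (400 * sqrt PI))); [field; lra|].
    transitivity (- ((1 / 2 + sqrt 5 / 10) * (201 + 24 * sqrt 5) / (200 * sqrt PI))); [|field; lra].
    replace ((1 / 2 + sqrt 5 / 10) * (201 + 24 * sqrt 5))
      with (201 / 2 + 24 / 10 * (sqrt 5 * sqrt 5) + sqrt 5 * (12 + 201 / 10)) by field.
    rewrite h5. replace (321 / sqrt 5) with (321 / 5 * sqrt 5).
    * field. lra.
    * replace 5 with (sqrt 5 * sqrt 5) at 1 by lra. field. lra.
Qed.
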